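(* Let $T$ be the tetrahedron with vertices $A=(0,0,0)$, $B=(1,0,0)$, $C=(0,1,0)$, $D=(0,0,6)$, with floor the triangle $ABC$. Let $(\ell_n)_{n\geq0}$ be defined by $\ell_0=1$ and, for $n\geq1$, \[\ell_n=6\,\frac{(n-1)!\,n!}{(2n+1)!}\sum_{k=0}^{n-1}\ell_k\,\ell_{n-1-k}.\] Then $Q_T(n)\geq\ell_n$ for all $n\geq0$.
   Context: $Q_T(n)$ is the probability that $n$ independent uniform random points $U_1,\dots,U_n$ in $T$ all lie on the boundary of ${\sf CH}(\{U_1,\dots,U_n\}\cup ABC)$ (where $ABC$ denotes the filled triangle), with $Q_T(0)=1$. *)

(* Defs.v *)
From HB Require Import structures.
From mathcomp Require Import all_boot all_order all_algebra.
From mathcomp Require Import all_classical all_reals all_analysis.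

Set Implicit Arguments.
Unset Strict Implicit.
Unset Printing Implicit Defensive.

Import Order.TTheory GRing.Theory Num.Theory.
Import numFieldNormedType.Exports.

Local Open Scope classical_set_scope.
Local Open Scope ring_scope.

(* The sup norm carried by the product type induces the usual topology of
   Euclidean 3-space; the measurable sets are those of the product of the
   Borel sigma-algebras. *)
Notation space3 R := (R * R * R)%type.

Definition convex_hull (R : realType) (V : lmodType R) (X : set V) : set V :=
  smallest (@convex_set R V) X.

Definition boundary (T : topologicalType) (X : set T) : set T :=
  closure X `\` X°.

Definition volume (R : realType) : set (space3 R) -> \bar R :=
  ((@lebesgue_measure R \x @lebesgue_measure R) \x @lebesgue_measure R)%E.

Section tetrahedron.
Variable R : realType.

Definition vA : space3 R := (0, 0, 0).
Definition vB : space3 R := (1, 0, 0).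
Definition vC : space3 R := (0, 1, 0).
Definition vD : space3 R := (0, 0, 6).

Definition tetrahedron : set (space3 R) := convex_hull [set vA; vB; vC; vD].

Definition floor_ABC : set (space3 R) := convex_hull [set vA; vB; vC].

End tetrahedron.

Arguments tetrahedron R : clear implicits.
Arguments floor_ABC R : clear implicits.

Section random_points.
Context {d : measure_display} {Omega : measurableType d} {R : realType}.
Variable P : probability Omega R.

(* Meaningful for measurable K with 0 < volume K < +oo. *)
Definition uniform_on (K : set (space3 R)) (X : {RV P >-> space3 R}) : Prop :=
  forall A : set (space3 R), measurable A ->
    distribution P X A = (volume (A `&` K) / volume K)%E.

Definition mutually_independent {d' : measure_display} {T : measurableType d'}
    {I : finType} (X : I -> {RV P >-> T}) : Prop :=
  forall (J : {set I}) (B : I -> set T), (forall i, measurable (B i)) ->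
    P (\bigcap_(i in [set` J]) (X i @^-1` B i)) =
    (\prod_(i in J) P (X i @^-1` B i))%E.

Definition all_on_hull_boundary (n : nat) (U : 'I_n -> {RV P >-> space3 R}) :
    set Omega :=
  [set w | forall i : 'I_n,
     boundary (convex_hull ([set U j w | j in [set: 'I_n]] `|` floor_ABC R))
       (U i w)].

End random_points.

(* Main.v *)
(* Write a, b, c, d for the barycentric coordinates. Single out the point u for
   which d / (a + b + d) is largest, i.e. the first one met by a plane through
   C, parallel to AB, rotating down from D. The parallel to AB through u meets
   the faces ACD and BCD at E and F. Suppose that the other points lie in the
   tetrahedra ACuE and BCuF, and that in each of them the points lie on the
   boundary of their hull with the floor ACu, resp. BCu. Then all the points lie
   on the boundary of their hull with ABC: u because of the rotating plane, and
   a point x of ACuE because from x everything in BCuF is seen through the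
   triangle ACu, so that the cone at x spanned by the hull does not grow.
   The two tetrahedra are affine images of T with volumes bd and ad, so
   conditionally on u the event splitting the other points as k + m has
   probability at least (bd)^k (ad)^m l_k l_m. Distinct choices of u and of the
   splitting give disjoint events, and the Dirichlet integral
   6 k! m! (k+m)! / (2(k+m)+3)! of (bd)^k (ad)^m over T turns the sum of these
   bounds into the recursion defining l_n. *)

Require Import Defs.
From HB Require Import structures.
From mathcomp Require Import all_boot all_order all_algebra.
From mathcomp Require Import all_classical all_reals all_analysis.
From mathcomp Require Import measurable_realfun ring lra zify.

Set Implicit Arguments.
Unset Strict Implicit.
Unset Printing Implicit Defensive.

Import Order.TTheory GRing.Theory Num.Theory.
Import numFieldNormedType.Exports.

Local Open Scope classical_set_scope.
Local Open Scope ring_scope.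

(** * Cones and hulls *)

(** The boundary condition is put in algebraic form: a point of a hull is interior exactly when the
    vectors from it to the generating points span the whole space as a convex cone. This form passes
    through affine maps and inclusions of cones, and its real weights can be discretised, which
    gives measurability. The points live on an arbitrary probability space, where fixing [u] would
    call for a disintegration. Since only the joint law matters, they are moved to a product of
    three copies of the space, where Tonelli's theorem fixes [u]. Sending a group of points into its
    subtetrahedron is then an event of positive probability, and conditioning on it only changes
    [P]. Hence the induction runs over subsets [J] of a fixed index type, on a fixed [Omega], with a
    bound valid for every [P]. The height 6 gives [T] volume 1, so probabilities are plain volumes.
    The strict inequalities only discard null sets, and they make the events disjoint. *)

Definition cone (R : realType) (V : lmodType R) (G : finType) (v : G -> V)
    (y : V) : Prop :=
  exists2 t : G -> R, forall g, 0 <= t g & y = \sum_g t g *: v g.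

Definition full_cone (R : realType) (V : lmodType R) (G : finType)
    (v : G -> V) : Prop := forall y, cone v y.

Section cones.
Variables (R : realType) (V : lmodType R).
Implicit Types (G H : finType) (y : V).

Lemma cone_gen G (v : G -> V) g : cone v (v g).
Proof.
exists (fun h => (h == g)%:R) => [h|]; first by case: (h == g).
rewrite (bigD1 g)//= eqxx scale1r big1 ?addr0// => h /negPf ->.
by rewrite scale0r.
Qed.

Lemma cone0 G (v : G -> V) : cone v 0.
Proof.
by exists (fun=> 0) => //; rewrite big1// => g _; rewrite scale0r.
Qed.

Lemma coneD G (v : G -> V) y y' : cone v y -> cone v y' -> cone v (y + y').
Proof.
move=> [t t0 ->] [t' t'0 ->]; exists (fun g => t g + t' g) => [g|].
  exact: addr_ge0.
by rewrite -big_split; apply: eq_bigr => g _; rewrite scalerDl.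
Qed.

Lemma coneZ G (v : G -> V) (a : R) y : 0 <= a -> cone v y -> cone v (a *: y).
Proof.
move=> a0 [t t0 ->]; exists (fun g => a * t g) => [g|]; first exact: mulr_ge0.
by rewrite scaler_sumr; apply: eq_bigr => g _; rewrite scalerA.
Qed.

Lemma cone_trans G H (v : G -> V) (w : H -> V) y :
  (forall g, cone w (v g)) -> cone v y -> cone w y.
Proof.
move=> vw [t t0 ->]; elim/big_ind: _ => [|y1 y2|g _].
- exact: cone0.
- exact: coneD.
- exact/coneZ/vw.
Qed.

Lemma full_cone_sub G H (v : G -> V) (w : H -> V) :
  (forall g, cone w (v g)) -> full_cone v -> full_cone w.
Proof. by move=> vw fv y; apply: cone_trans vw (fv y). Qed.

Lemma full_cone_linear G (v : G -> V) (f : {linear V -> V}) :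
  (forall y, exists y', f y' = y) -> full_cone v -> full_cone (f \o v).
Proof.
move=> fs fv y; have [y' <-] := fs y; have [t t0 ->] := fv y'.
exists t => //; rewrite linear_sum; apply: eq_bigr => g _.
by rewrite linearZ.
Qed.

Lemma not_full_cone G (v : G -> V) (f : {scalar V}) y :
  (forall g, f (v g) <= 0) -> 0 < f y -> ~ full_cone v.
Proof.
move=> fv fy /(_ y)[t t0 ty]; move: fy; apply/negP; rewrite -leNgt ty.
rewrite linear_sum; apply: sumr_le0 => g _; rewrite linearZ.
exact: mulr_ge0_le0.
Qed.

End cones.

(** Indices outside [J] contribute the zero vector, which adds nothing to a cone; the generators
    thus have the same index type for all [J]. *)
Definition gens (R : realType) (V : lmodType R) (I : finType) (F : 'I_3 -> V)
    (J : {set I}) (p : I -> V) (x : V) (g : 'I_3 + I) : V :=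
  match g with
  | inl k => F k - x
  | inr j => if j \in J then p j - x else 0
  end.

(* For a subset J of the indices, says that every point p i with i \in J lies
   on the boundary of the convex hull of F and {p j | j \in J}: see
   interior_hullP. *)
Definition exposed (R : realType) (V : lmodType R) (I : finType) (F : 'I_3 -> V)
    (J : {set I}) (p : I -> V) : Prop :=
  forall i, i \in J -> ~ full_cone (gens F J p (p i)).

Definition tri (V : Type) (a b c : V) (k : 'I_3) : V :=
  if val k is k'.+1 then if k' is 0 then b else c else a.

(** * The two subtetrahedra below a point and their mutual visibility *)

Section tetrahedra.
Variable R : realType.
Notation V := (space3 R).
Implicit Types (u p q : V).

(** The barycentric weight of [A]; those of [B], [C], [D] are [p.1.1], [p.1.2] and [p.2 / 6]. *)
Definition bary_a p : R := 1 - p.1.1 - p.1.2 - p.2 / 6.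

Definition open_tetra : set V :=
  [set p | [/\ 0 < p.1.1, 0 < p.1.2, 0 < p.2 & 0 < bary_a p]].

(* With E and F the points where the parallel to AB through u meets the faces
   ACD and BCD, these are the interiors of the tetrahedra A, C, u, E and
   B, C, u, F. *)
Definition tetra1 u : set V :=
  [set p | [/\ 0 < p.1.1, p.1.1 * u.2 < p.2 * u.1.1, u.1.2 * p.2 < p.1.2 * u.2
             & p.2 * (1 - u.1.2) < (1 - p.1.2) * u.2]].

Definition tetra2 u : set V :=
  [set p | [/\ 0 < bary_a p, bary_a p * u.2 < p.2 * bary_a u,
               u.1.2 * p.2 < p.1.2 * u.2
             & p.2 * (1 - u.1.2) < (1 - p.1.2) * u.2]].

Lemma prod3_eq p q : p.1.1 = q.1.1 -> p.1.2 = q.1.2 -> p.2 = q.2 -> p = q.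
Proof. by case: p q => [[? ?] ?] [[? ?] ?]/= -> -> ->. Qed.

Lemma cone3 (G : finType) (v : G -> V) (i j k : G) (a b c : R) y :
  0 <= a -> 0 <= b -> 0 <= c ->
  y = a *: v i + b *: v j + c *: v k -> cone v y.
Proof.
by move=> a0 b0 c0 ->; apply: coneD; [apply: coneD|];
  apply: coneZ => //; exact: cone_gen.
Qed.

(* tau = 1 - al - be - ga is the nonpositive weight of (X, Y, Z) in the affine
   combination giving (q1, q2, q3). *)
Lemma shadow_coeffs (u1 u2 u3 X Y Z q1 q2 q3 : R) :
  0 < u3 -> 0 < Z -> X * u3 < Z * u1 -> u2 * Z < Y * u3 ->
  Z * (1 - u2) < (1 - Y) * u3 ->
  0 <= q3 -> q3 * u1 <= q1 * u3 -> u2 * q3 <= q2 * u3 ->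
  q3 * (1 - u2) <= (1 - q2) * u3 ->
  exists al be ga, [/\ 0 <= al, 0 <= be & 0 <= ga] /\ [/\
    q1 = (1 - al - be - ga) * X + be * u1,
    q2 = (1 - al - be - ga) * Y + be * u2 + ga &
    q3 = (1 - al - be - ga) * Z + be * u3].
Proof.
move=> u30 Z0 T1 T2 T3 q30 Q1 Q2 Q3.
have D0 : X * u3 - Z * u1 < 0 by lra.
(* The form [x * u3 - z * u1] vanishes at [A], [u] and [C], so [tau] is the ratio of its values at
   [q] and at the viewpoint [(X, Y, Z)], which have opposite signs. *)
pose tau := (q1 * u3 - q3 * u1) / (X * u3 - Z * u1).
have tau0 : tau <= 0.
  by rewrite /tau ler_ndivrMr// mul0r; lra.
have u3n : u3 != 0 by rewrite gt_eqF.
have Dn : X * u3 - Z * u1 != 0 by rewrite lt_eqF.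
pose be := (q3 - tau * Z) / u3.
pose ga := q2 - tau * Y - be * u2.
exists (1 - tau - be - ga), be, ga.
have -> : 1 - (1 - tau - be - ga) - be - ga = tau by ring.
split; split.
(* The form [(1 - y) * u3 - z * (1 - u2)] vanishes at [u] and [C] and equals [u3] at [A]; it is
   nonnegative at [q] and at the viewpoint, whose weight is [tau <= 0]. The weight [ga] comes
   likewise from [y * u3 - u2 * z], which vanishes at [A] and [u]. *)
- have -> : 1 - tau - be - ga =
     (((1 - q2) * u3 - q3 * (1 - u2)) - tau * ((1 - Y) * u3 - Z * (1 - u2))) / u3.
    by rewrite /ga /be; field.
  apply: divr_ge0; last exact: ltW.
  rewrite subr_ge0; apply: (@le_trans _ _ 0); last by rewrite subr_ge0.
  by apply: mulr_le0_ge0 => //; rewrite subr_ge0 ltW.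
- apply: divr_ge0; last exact: ltW.
  by rewrite subr_ge0 (le_trans _ q30)// mulr_le0_ge0// ltW.
- have -> : ga = ((q2 * u3 - u2 * q3) - tau * (Y * u3 - u2 * Z)) / u3.
    by rewrite /ga /be; field.
  apply: divr_ge0; last exact: ltW.
  rewrite subr_ge0; apply: (@le_trans _ _ 0); last by rewrite subr_ge0.
  by apply: mulr_le0_ge0 => //; rewrite subr_ge0 ltW.
- by rewrite /be /tau; field; apply/andP.
- by rewrite /ga; ring.
- by rewrite /be; field.
Qed.

Lemma open_tetra_y_lt1 u : open_tetra u -> u.1.2 < 1.
Proof. by case; rewrite /bary_a; lra. Qed.

(** Adding the second and fourth inequalities of [tetra1] gives the inequality of the plane [BCu]:
    this subtetrahedron lies on the side of [A], whereas [tetra2] lies strictly on the other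
    side. *)
Lemma tetra1_ge u p : open_tetra u -> tetra1 u p ->
  0 < p.2 /\ p.2 * bary_a u <= bary_a p * u.2.
Proof.
move=> [u1 u2 u3 ua] [p1 P1 P2 P3].
have p20 : 0 < p.2 by rewrite -(pmulr_lgt0 _ u1) (le_lt_trans _ P1)// mulr_ge0// ltW.
by split => //; rewrite /bary_a in ua *; lra.
Qed.

Lemma tetra2_ge u p : open_tetra u -> tetra2 u p ->
  0 < p.2 /\ p.2 * u.1.1 <= p.1.1 * u.2.
Proof.
move=> [u1 u2 u3 ua] [p1 P1 P2 P3].
have p20 : 0 < p.2 by rewrite -(pmulr_lgt0 _ ua) (le_lt_trans _ P1)// mulr_ge0// ltW.
by split => //; rewrite /bary_a in ua p1 P1; lra.
Qed.

Lemma tetra12_disj u p : open_tetra u -> tetra1 u p -> tetra2 u p -> False.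
Proof.
by move=> uT /(tetra1_ge uT)[_ h] [_ + _ _]; rewrite ltNge h.
Qed.

(* From a point of the first subtetrahedron, B and the second subtetrahedron
   are seen through the triangle A, C, u. *)
Lemma tetra1_shadow u p q : open_tetra u -> tetra1 u p ->
  0 <= q.2 -> q.2 * u.1.1 <= q.1.1 * u.2 -> u.1.2 * q.2 <= q.1.2 * u.2 ->
  q.2 * (1 - u.1.2) <= (1 - q.1.2) * u.2 ->
  exists al be ga, [/\ 0 <= al, 0 <= be, 0 <= ga &
    q - p = al *: (vA R - p) + be *: (u - p) + ga *: (vC R - p)].
Proof.
move=> uT pT; have [p3 _] := tetra1_ge uT pT.
case: uT pT => [u1 u2 u3 ua] [p1 P1 P2 P3] q3 Q1 Q2 Q3.
have [al [be [ga [[a0 b0 c0] [E1 E2 E3]]]]] := shadow_coeffs u3 p3 P1 P2 P3 q3 Q1 Q2 Q3.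
exists al, be, ga; split => //.
by apply: prod3_eq => /=; rewrite ?E1 ?E2 ?E3 /GRing.scale/=; ring.
Qed.

(** [shadow_coeffs] with the weight of [A] as first coordinate, which exchanges the roles of [A] and
    [B]. *)
Lemma tetra2_shadow u p q : open_tetra u -> tetra2 u p ->
  0 <= q.2 -> q.2 * bary_a u <= bary_a q * u.2 -> u.1.2 * q.2 <= q.1.2 * u.2 ->
  q.2 * (1 - u.1.2) <= (1 - q.1.2) * u.2 ->
  exists al be ga, [/\ 0 <= al, 0 <= be, 0 <= ga &
    q - p = al *: (vB R - p) + be *: (u - p) + ga *: (vC R - p)].
Proof.
move=> uT pT; have [p3 _] := tetra2_ge uT pT.
case: uT pT => [u1 u2 u3 ua] [p1 P1 P2 P3] q3 Q1 Q2 Q3.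
have [al [be [ga [[a0 b0 c0] [E1 E2 E3]]]]] := shadow_coeffs u3 p3 P1 P2 P3 q3 Q1 Q2 Q3.
exists al, be, ga; split => //.
apply: prod3_eq => /=; rewrite ?E2 ?E3 /GRing.scale/=; [|ring|ring].
have -> : q.1.1 = 1 - bary_a q - q.1.2 - q.2 / 6 by rewrite /bary_a; field.
by rewrite E1 E2 E3 /bary_a; field.
Qed.

Definition floor3 : 'I_3 -> V := tri (vA R) (vB R) (vC R).

Lemma ord3P (P : 'I_3 -> Prop) :
  P ord0 -> P (lift ord0 ord0) -> P ord_max -> forall k, P k.
Proof.
move=> P0 P1 P2 [[|[|[|//]]] k3].
- by rewrite (_ : Ordinal _ = ord0)//; exact: val_inj.
- by rewrite (_ : Ordinal _ = lift ord0 ord0)//; exact: val_inj.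
- by rewrite (_ : Ordinal _ = ord_max)//; exact: val_inj.
Qed.

Lemma tri_shadow_cone (I : finType) (a b c : V) (J : {set I}) (pt : I -> V)
    (p y : V) al be ga :
  0 <= al -> 0 <= be -> 0 <= ga ->
  y = al *: (a - p) + be *: (b - p) + ga *: (c - p) ->
  cone (gens (tri a b c) J pt p) y.
Proof.
move=> a0 b0 c0 ->.
exact: (@cone3 _ _ (inl ord0) (inl (lift ord0 ord0)) (inl ord_max)
  al be ga).
Qed.

Lemma gens_cone_floor (I : finType) (F : 'I_3 -> V) (J : {set I}) pt p k :
  cone (gens F J pt p) (F k - p).
Proof. exact: (@cone_gen _ _ _ (gens F J pt p) (inl k)). Qed.

Lemma gens_cone_pt (I : finType) (F : 'I_3 -> V) (J : {set I}) pt p j :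
  j \in J -> cone (gens F J pt p) (pt j - p).
Proof.
move=> jJ; have := @cone_gen _ _ _ (gens F J pt p) (inr j).
by rewrite /gens jJ.
Qed.

(* The linear functional vanishing on the plane through C and u parallel to
   AB. *)
Lemma apex_not_full (I : finType) (J : {set I}) (pt : I -> V) u :
  open_tetra u ->
  (forall j, j \in J -> (pt j).2 * (1 - u.1.2) <= (1 - (pt j).1.2) * u.2) ->
  ~ full_cone (gens floor3 J pt u).
Proof.
move=> uT h.
pose f (v : V) : R := v.2 * (1 - u.1.2) + v.1.2 * u.2.
have flin : scalar f.
  by move=> a v w; rewrite /f /= /GRing.scale /=; ring.
pose fL := GRing.isLinear.Build R V R *%R f flin.
pose g : {scalar V} := HB.pack f fL.
have u21 := open_tetra_y_lt1 uT.
case: uT => u1 u2 u3 ua.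
apply: (@not_full_cone _ _ _ _ g ((0, 0, 1) : V)); last first.
  by rewrite /= /f /=; lra.
move=> [k|j] /=.
  move: k; apply: ord3P; rewrite /f /floor3/tri /=; nra.
case: ifPn => [jJ|_]; last by rewrite /f /= !mul0r addr0.
by rewrite /f /=; have := h _ jJ; lra.
Qed.

(** By contraposition: seen from a point of one group, every generator of the large hull lies in the
    cone generated by that group and its own floor, so a full cone would already be full for the
    group alone. *)
Lemma exposed_glue (I : finType) (J1 J2 : {set I}) (i : I) (pt : I -> V) :
  open_tetra (pt i) ->
  (forall j, j \in J1 -> tetra1 (pt i) (pt j)) ->
  (forall j, j \in J2 -> tetra2 (pt i) (pt j)) ->
  exposed (tri (vA R) (pt i) (vC R)) J1 pt ->
  exposed (tri (vB R) (pt i) (vC R)) J2 pt ->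
  exposed floor3 (i |: (J1 :|: J2)) pt.
Proof.
move=> uT h1 h2 e1 e2 j; rewrite !inE => /orP[/eqP ->|/orP[jJ|jJ]].
- apply: apex_not_full => // k; rewrite !inE => /orP[/eqP ->|/orP[kJ|kJ]].
  + by rewrite mulrC.
  + by have [_ _ _ /ltW] := h1 _ kJ.
  + by have [_ _ _ /ltW] := h2 _ kJ.
- have u3 : 0 < (pt i).2 by case: uT.
  have jT := h1 _ jJ; move=> fj; apply: (e1 _ jJ).
  apply: full_cone_sub fj => -[k|k] /=.
    move: k; apply: ord3P; rewrite /floor3/tri /=.
    - exact: (gens_cone_floor _ _ _ _ ord0).
    (* [B] is not a vertex of the floor [A, u, C], but it too is seen through that triangle. *)
    - have [||||al [be [ga [a0 b0 c0 E]]]] := @tetra1_shadow _ _ (vB R) uT jT => /=;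
        try by nra.
      exact: tri_shadow_cone a0 b0 c0 E.
    - exact: (gens_cone_floor _ _ _ _ ord_max).
  rewrite !inE; case: ifPn => [|_]; last exact: cone0.
  move=> /orP[/eqP ->|/orP[kJ|kJ]].
  + exact: (gens_cone_floor _ _ _ _ (lift ord0 ord0)).
  + exact: gens_cone_pt.
  + have [k3 kx] := tetra2_ge uT (h2 _ kJ); have [_ _ k2 k4] := h2 _ kJ.
    have [||||al [be [ga [a0 b0 c0 E]]]] := @tetra1_shadow _ _ (pt k) uT jT => //;
      try exact: ltW.
    exact: tri_shadow_cone a0 b0 c0 E.
- have u3 : 0 < (pt i).2 by case: uT.
  have jT := h2 _ jJ; move=> fj; apply: (e2 _ jJ).
  apply: full_cone_sub fj => -[k|k] /=.
    move: k; apply: ord3P; rewrite /floor3/tri /=.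
    - have [||||al [be [ga [a0 b0 c0 E]]]] := @tetra2_shadow _ _ (vA R) uT jT;
        rewrite /bary_a /=; try by nra.
      exact: tri_shadow_cone a0 b0 c0 E.
    - exact: (gens_cone_floor _ _ _ _ ord0).
    - exact: (gens_cone_floor _ _ _ _ ord_max).
  rewrite !inE; case: ifPn => [|_]; last exact: cone0.
  move=> /orP[/eqP ->|/orP[kJ|kJ]].
  + exact: (gens_cone_floor _ _ _ _ (lift ord0 ord0)).
  + have [k3 kx] := tetra1_ge uT (h1 _ kJ); have [_ _ k2 k4] := h1 _ kJ.
    have [||||al [be [ga [a0 b0 c0 E]]]] := @tetra2_shadow _ _ (pt k) uT jT => //;
      try exact: ltW.
    exact: tri_shadow_cone a0 b0 c0 E.
  + exact: gens_cone_pt.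
Qed.

End tetrahedra.

(** * Convex hulls, feasible directions and interior points *)

Section convex_hulls.
Variables (R : realType) (V : lmodType R).
Implicit Types (K X : set V) (x y : V).

(** Convexity with a real weight and explicit bounds, in place of the bundled weights of
    [convex_set]. *)
Definition segment_closed K : Prop := forall x y (t : R), 0 <= t -> t <= 1 ->
  K x -> K y -> K (t *: x + (1 - t) *: y).

Lemma segment_closedP K : @convex_set R V K <-> segment_closed K.
Proof.
split=> [cK x y t t0 t1 Kx Ky|cK x y l].
  have t01 : Itv.spec (@Itv.num_sem R)
      (Itv.Real (Interval (BLeft 0%Z) (BRight 1%Z))) t.
    by rewrite /= /Itv.num_sem /= num_real/= in_itv/= t0 t1.
  have /set_mem := @cK x y (Itv.mk t01) (mem_set Kx) (mem_set Ky).
  by move=> h; exact: h.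
rewrite !inE => Kx Ky; apply: cK => //.
Qed.

Lemma convex_hull_segment_closed X : segment_closed (convex_hull X).
Proof.
move=> x y t t0 t1 Kx Ky A cAX; have [/segment_closedP cA _] := cAX.
by apply: cA => //; [exact: Kx|exact: Ky].
Qed.

Lemma sub_convex_hull X : X `<=` convex_hull X.
Proof. by move=> x Xx A [_]; apply. Qed.

Lemma convex_hull_sub X K : segment_closed K -> X `<=` K -> convex_hull X `<=` K.
Proof. by move=> cK XK x; apply; split => //; exact/segment_closedP. Qed.

End convex_hulls.

Section interior_of_hull.
Variable R : realType.
Notation V := (space3 R).
Implicit Types (x y v : V) (K : set V).

Lemma prod3_ball x y (e : R) : ball x e y <->
  [/\ `|x.1.1 - y.1.1| < e, `|x.1.2 - y.1.2| < e & `|x.2 - y.2| < e].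
Proof. by split=> [[[? ?] ?]|[? ? ?]]. Qed.

(** The feasible directions of [K] at [x]. The step may depend on the direction; for convex [K]
    these directions form a convex cone. *)
Definition radial K x v : Prop := exists2 e : R, 0 < e & K (x + e *: v).

Section radial.
Variables (K : set V) (x : V).
Hypotheses (cK : segment_closed K) (Kx : K x).

Lemma radial_le v (e e' : R) : 0 <= e' -> e' <= e -> K (x + e *: v) ->
  K (x + e' *: v).
Proof.
move=> e'0 e'e Ke; have [e0|e0] := eqVneq e 0.
  by have -> : e' = e by apply/eqP; rewrite eq_le e'e e0.
have ep : 0 < e by rewrite lt_neqAle eq_sym e0 (le_trans e'0).
have -> : x + e' *: v = (e' / e) *: (x + e *: v) + (1 - e' / e) *: x.
  rewrite scalerDr addrAC -scalerDl addrCA subrr addr0 scale1r scalerA.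
  by rewrite mulrVK// unitfE.
by apply: cK => //; [rewrite divr_ge0// ltW|rewrite ler_pdivrMr// mul1r].
Qed.

Lemma radial0 : radial K x 0.
Proof. by exists 1 => //; rewrite scaler0 addr0. Qed.

Lemma radialD v w : radial K x v -> radial K x w -> radial K x (v + w).
Proof.
move=> [e e0 Ke] [f f0 Kf]; pose m := Num.min e f.
have m0 : 0 < m by rewrite lt_min e0.
have Kem : K (x + m *: v) by apply: radial_le Ke; [exact: ltW|rewrite ge_min lexx].
have Kfm : K (x + m *: w).
  by apply: radial_le Kf; [exact: ltW|rewrite ge_min lexx orbT].
exists (m / 2); first by rewrite divr_gt0.
have -> : x + (m / 2) *: (v + w) =
    2^-1 *: (x + m *: v) + (1 - 2^-1) *: (x + m *: w).
  by apply: prod3_eq; rewrite /= /GRing.scale /=; field.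
by apply: cK => //; lra.
Qed.

Lemma radialZ v (a : R) : 0 <= a -> radial K x v -> radial K x (a *: v).
Proof.
rewrite le_eqVlt => /predU1P[<- _|a0 [e e0 Ke]].
  by rewrite scale0r; exact: radial0.
exists (e / a); first exact: divr_gt0.
by rewrite scalerA mulrVK// unitfE gt_eqF.
Qed.

Lemma cone_radial (G : finType) (v : G -> V) y :
  (forall g, radial K x (v g)) -> cone v y -> radial K x y.
Proof.
move=> vK [t t0 ->]; elim/big_ind: _ => [|y1 y2|g _].
- exact: radial0.
- exact: radialD.
- exact/radialZ/vK.
Qed.

Lemma radial_line v : radial K x v -> radial K x (- v) ->
  exists2 e : R, 0 < e & forall s, `|s| <= e -> K (x + s *: v).
Proof.
move=> [e e0 Ke] [f f0 Kf]; exists (Num.min e f) => [|s]; first by rewrite lt_min e0.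
rewrite le_min => /andP[se sf]; have [s0|s0] := leP 0 s.
  by apply: radial_le Ke => //; rewrite -(ger0_norm s0).
have -> : s *: v = `|s| *: - v by rewrite ltr0_norm// scaleNr scalerN opprK.
exact: radial_le Kf.
Qed.

Lemma radial_interior : (forall v, radial K x v) -> K° x.
Proof.
move=> rK.
have [a a0 Ka] := radial_line (rK ((1, 0, 0) : V)) (rK _).
have [b b0 Kb] := radial_line (rK ((0, 1, 0) : V)) (rK _).
have [c c0 Kc] := radial_line (rK ((0, 0, 1) : V)) (rK _).
pose e := Num.min a (Num.min b c).
have e0 : 0 < e by rewrite !lt_min a0 b0.
(* A point of this ball is the average of three points, each displaced from [x] along one axis by
   three times a coordinate. [prod3_ball] bounds [x - y], whence the sign in [h]. *)
apply/nbhs_ballP; exists (e / 3) => [|y /prod3_ball[y1 y2 y3]] /=.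
  by rewrite divr_gt0.
have h (s d : R) : e <= d -> `|s| < e / 3 -> `|- (3 * s)| <= d.
  move=> ed se; rewrite normrN normrM ger0_norm// (le_trans _ ed)//.
  by move: se; rewrite ltr_pdivlMr// mulrC => /ltW.
have ea : e <= a by rewrite /e ge_min lexx.
have eb : e <= b by rewrite /e !ge_min lexx !orbT.
have ec : e <= c by rewrite /e !ge_min lexx !orbT.
have {}y1 := Ka _ (h _ _ ea y1).
have {}y2 := Kb _ (h _ _ eb y2).
have {}y3 := Kc _ (h _ _ ec y3).
have k3 : 0 <= 3^-1 :> R by rewrite invr_ge0.
have k31 : 3^-1 <= 1 :> R by rewrite invf_le1// ler1n.
have k2 : 0 <= 2^-1 :> R by rewrite invr_ge0.
have k21 : 2^-1 <= 1 :> R by rewrite invf_le1// ler1n.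
have := cK k3 k31 y1 (cK k2 k21 y2 y3); congr K.
by apply: prod3_eq; rewrite /= /GRing.scale /=; field.
Qed.

End radial.

(** If the cone is full, every direction is feasible, as the feasible ones form a cone containing
    the generators. Conversely, the translated cone is convex and contains the hull, hence a ball
    around [p i], and scaling the ball reaches every vector. *)
Lemma interior_hullP (I : finType) (p : I -> V) (i : I) :
  (convex_hull ([set p j | j in [set: I]] `|` floor_ABC R))° (p i) <->
  full_cone (gens (floor3 R) finset.setT p (p i)).
Proof.
set K := convex_hull _.
have Kp j : K (p j) by apply: sub_convex_hull; left; exists j.
have Kf k : K (floor3 R k).
  apply: sub_convex_hull; right; apply: sub_convex_hull.
  by move: k; apply: ord3P; [left; left|left; right|right].
have cK : segment_closed K by exact: convex_hull_segment_closed.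
split=> [/nbhs_ballP[e /= e0 eK] y|fp]; last first.
  apply: radial_interior => // v; apply: cone_radial (fp v) => // -[k|j].
  - by exists 1 => //; rewrite scale1r /= addrC subrK.
  - rewrite /gens; case: ifPn => _; last exact: radial0.
    by exists 1 => //; rewrite scale1r addrC subrK.
set v := gens _ _ _ _.
have cc : segment_closed [set z | cone v (z - p i)].
  move=> z z' t t0 t1 /= cz cz'.
  have -> : t *: z + (1 - t) *: z' - p i = t *: (z - p i) + (1 - t) *: (z' - p i).
    by apply: prod3_eq; rewrite /= /GRing.scale /=; ring.
  by apply: coneD; apply: coneZ => //; rewrite subr_ge0.
have Kc : K `<=` [set z | cone v (z - p i)].
  apply: convex_hull_sub => // z [[j _ <-]|]; first by apply: gens_cone_pt; rewrite inE.
  apply: convex_hull_sub => // _ [[->|->]|->].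
  - exact: (gens_cone_floor _ _ _ _ ord0).
  - exact: (gens_cone_floor _ _ _ _ (lift ord0 ord0)).
  - exact: (gens_cone_floor _ _ _ _ ord_max).
(* [N] strictly exceeds every coordinate of [y] in modulus, so [p i + (e / N) *: y] is in the
   ball. *)
pose N := 1 + `|y.1.1| + `|y.1.2| + `|y.2|.
have N0 : 0 < N by rewrite /N -!addrA ltr_pwDl// !addr_ge0.
pose s := e / N.
have s0 : 0 < s by rewrite divr_gt0.
have -> : y = s^-1 *: ((p i + s *: y) - p i).
  by rewrite addrAC subrr add0r scalerA mulVf ?scale1r// gt_eqF.
apply: coneZ; first by rewrite invr_ge0 ltW.
apply: Kc; apply: eK; apply/prod3_ball => /=.
have h (a b : R) : `|a| < N -> `|b - (b + s * a)| < e.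
  move=> aN; rewrite opprD addrA subrr add0r normrN normrM gtr0_norm//.
  by rewrite /s mulrAC ltr_pdivrMr// ltr_pM2l.
have n1 := normr_ge0 y.1.1; have n2 := normr_ge0 y.1.2; have n3 := normr_ge0 y.2.
by split; apply: h; rewrite /N; lra.
Qed.

Lemma boundary_hullP (I : finType) (p : I -> V) :
  (forall i, boundary
     (convex_hull ([set p j | j in [set: I]] `|` floor_ABC R)) (p i)) <->
  exposed (floor3 R) finset.setT p.
Proof.
split=> [h i _ /interior_hullP|h i]; first by case: (h i).
split; last by move/interior_hullP; apply: h; rewrite inE.
by apply: subset_closure; apply: sub_convex_hull; left; exists i.
Qed.

End interior_of_hull.

(** [psi] is the linear part of the affine map [phi]; being surjective, it carries full cones to
    full cones. *)
Lemma exposed_affine (R : realType) (V : lmodType R) (I : finType)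
    (F : 'I_3 -> V) (J : {set I}) (p : I -> V) (phi : V -> V)
    (psi : {linear V -> V}) :
  (forall q q', phi q - phi q' = psi (q - q')) ->
  (forall y, exists y', psi y' = y) ->
  exposed (phi \o F) J (phi \o p) -> exposed F J p.
Proof.
move=> phiE psis e i iJ fi; apply: e (iJ) _.
apply: full_cone_sub (full_cone_linear psis fi) => g.
suff -> : (psi \o gens F J p (p i)) g = gens (phi \o F) J (phi \o p) ((phi \o p) i) g.
  exact: cone_gen.
by case: g => [k|j] /=; [|case: ifPn => _; rewrite ?linear0]; rewrite ?phiE.
Qed.

(** * Measurability *)

Section closed_cone.
Variable R : realType.
Notation V := (space3 R).

Definition coord (c : 'I_3) (p : V) : R := tri p.1.1 p.1.2 p.2 c.

Lemma coord_eqP (p q : V) : (forall c, coord c p = coord c q) -> p = q.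
Proof.
move=> h; apply: prod3_eq; [exact: (h ord0)|exact: (h (lift ord0 ord0))|].
exact: (h ord_max).
Qed.

Lemma coord_linear c : scalar (coord c).
Proof. by move=> a p q; move: c; exact: ord3P. Qed.

HB.instance Definition _ c :=
  GRing.isLinear.Build R V R *%R (coord c) (coord_linear c).

Variable G : finType.
Implicit Types (v : G -> V) (t : G -> R) (y : V).

Lemma coord_sum c t v :
  coord c (\sum_g t g *: v g) = \sum_g t g * coord c (v g).
Proof. by rewrite linear_sum; apply: eq_bigr => g _; rewrite linearZ. Qed.

(* The weights are restricted to a grid of mesh 1/(n+1), so that membership in
   the cone becomes a countable combination of closed conditions. *)
Definition grid_cone v y (N n : nat) (k : {ffun G -> 'I_(N * n.+1).+1}) : Prop :=
  forall c : 'I_3,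
    `|\sum_g (k g)%:R / n.+1%:R * coord c (v g) - coord c y| <=
    (\sum_g `|coord c (v g)|) / n.+1%:R.

(** Each weight is rounded down to the mesh, an error below [1 / (n + 1)] per generator. [N] bounds
    all weights and is chosen before [n]. *)
Lemma cone_grid v y : cone v y -> exists N, forall n, exists k, @grid_cone v y N n k.
Proof.
move=> [t t0 ->]; exists (Num.trunc (\sum_g t g)).+1 => n.
set N := (Num.trunc _).+1.
have n0 : 0 < n.+1%:R :> R by rewrite ltr0n.
have tN g : t g < N%:R.
  have /andP[_] : (Num.trunc (\sum_g t g))%:R <= \sum_g t g < N%:R.
    by apply: truncn_itv; exact: sumr_ge0.
  apply: le_lt_trans; rewrite (bigD1 g)//= lerDl; exact: sumr_ge0.
have tn g : (Num.trunc (t g * n.+1%:R))%:R <= t g * n.+1%:R <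
    (Num.trunc (t g * n.+1%:R)).+1%:R by apply: truncn_itv; exact: mulr_ge0.
have tl g : (Num.trunc (t g * n.+1%:R) < (N * n.+1).+1)%N.
  have /andP[h _] := tn g; rewrite ltnS -(ler_nat R) (le_trans h)// natrM.
  by rewrite ler_wpM2r// ltW.
exists [ffun g => Ordinal (tl g)] => c.
rewrite coord_sum -sumrB mulr_suml (le_trans (ler_norm_sum _ _ _))//.
apply: ler_sum => g _; rewrite ffunE /= -mulrBl normrM mulrC ler_wpM2l//.
have /andP[h1 h2] := tn g.
rewrite distrC ger0_norm; last by rewrite subr_ge0 ler_pdivrMr.
rewrite lerBlDr -[X in _ <= X + _]mul1r -mulrDl ler_pdivlMr// nat1r.
exact: ltW.
Qed.

Lemma ler_div_nat_le0 (a b : R) : (forall n : nat, a <= b / n.+1%:R) -> a <= 0.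
Proof.
move=> h; rewrite leNgt; apply/negP => a0.
have := h (Num.trunc (`|b| / a)); rewrite ler_pdivlMr ?ltr0n//; apply/negP.
rewrite -ltNge (le_lt_trans (ler_norm b))// mulrC -ltr_pdivrMr//.
by have /andP[] := @truncn_itv R (`|b| / a) (divr_ge0 (normr_ge0 _) (ltW a0)).
Qed.

Lemma continuous_norm_sums (T : topologicalType) (I J : Type) (r : seq I)
    (s : seq J) (f : J -> T -> R) (a : I -> J -> R) (b : I -> R) :
  (forall j, continuous (f j)) ->
  continuous (fun x => \sum_(i <- r) `|\sum_(j <- s) f j x * a i j - b i|).
Proof.
move=> cf; apply: continuous_big => [|i _ x]; first exact: add_continuous.
apply: cvg_norm; apply: cvgB; last exact: cvg_cst.
apply: (@continuous_big _ _ _ _ xpredT) => [|j _ z]; first exact: add_continuous.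
by apply: cvgM; [exact: cf|exact: cvg_cst].
Qed.

(** Compactness: the total error [f] attains its minimum on the cube of side [N]. Grid points make
    it at most a constant over [n + 1] for every [n], so the minimum is 0 and a minimiser gives
    exact weights. *)
Lemma grid_cone_cone v y N :
  (forall n, exists k, @grid_cone v y N n k) -> cone v y.
Proof.
move=> h.
pose A := [set t : 'rV[R]_#|G| | forall i, `[0, N%:R]%classic (t ord0 i)].
pose f (t : 'rV[R]_#|G|) : R := \sum_(c : 'I_3)
  `|\sum_g t ord0 (enum_rank g) * coord c (v g) - coord c y|.
have cA : compact A.
  have := @rV_compact R #|G| (fun=> `[0, N%:R]%classic) (fun=> @segment_compact R _ _). by [].
have cf : continuous f.
  apply: (@continuous_norm_sums _ _ _ _ _
    (fun g (t : 'rV[R]_#|G|) => t ord0 (enum_rank g))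
    (fun c g => coord c (v g)) (coord^~ y)) => g.
  exact: coord_continuous.
have A0 : A !=set0.
  by exists 0 => i; rewrite /= mxE in_itv /= lexx ler0n.
have [t /set_mem At tm] := EVT_min_rV A0 cA (continuous_subspaceT cf).
have ft : f t <= 0.
  apply: (@ler_div_nat_le0 _ (\sum_(c : 'I_3) \sum_g `|coord c (v g)|)) => n.
  have [k kP] := h n.
  have n0 : 0 < n.+1%:R :> R by rewrite ltr0n.
  have : (\row_i ((k (enum_val i))%:R / n.+1%:R) : 'rV[R]_#|G|) \in A.
    rewrite inE => i; rewrite /= mxE in_itv /= divr_ge0// ler_pdivrMr// -natrM ler_nat.
    by have := ltn_ord (k (enum_val i)).
  move=> /tm /le_trans; apply; rewrite /f mulr_suml; apply: ler_sum => c _.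
  apply: le_trans (kP c); rewrite le_eqVlt; apply/orP; left; apply/eqP.
  by congr `| _ - _ |; apply: eq_bigr => g _; rewrite mxE enum_rankK.
exists (fun g => t ord0 (enum_rank g)) => [g|].
  by have := At (enum_rank g); rewrite /= in_itv => /andP[].
apply/esym/coord_eqP => c; rewrite coord_sum; apply/eqP.
rewrite -subr_eq0 -normr_le0 (le_trans _ ft)// /f (bigD1 c)//= lerDl.
exact: sumr_ge0.
Qed.

Lemma cone_gridP v y :
  cone v y <-> exists N, forall n, exists k, @grid_cone v y N n k.
Proof. by split=> [|[N]]; [exact: cone_grid|exact: grid_cone_cone]. Qed.

Definition signed_axis (s : bool * 'I_3) : V :=
  (-1) ^+ s.1 *: tri (1, 0, 0) (0, 1, 0) (0, 0, 1) s.2.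

(** Six test directions replace the uncountable quantification over [y], so that fullness becomes a
    finite intersection of events. *)
Lemma full_cone_axes v : full_cone v <-> forall s, cone v (signed_axis s).
Proof.
split=> [h s|h y]; first exact: h.
have -> : y = \sum_c `|coord c y| *: signed_axis (coord c y < 0, c).
  apply/coord_eqP => c; rewrite linear_sum (bigD1 c)//= big1 => [|d dc].
    rewrite addr0 !linearZ /=.
    have -> : coord c (tri (1, 0, 0) (0, 1, 0) (0, 0, 1) c) = 1.
      by move: c; exact: ord3P.
    by rewrite mulr1 mulrC; exact: numEsign.
  rewrite !linearZ /=.
  have -> : coord c (tri (1, 0, 0) (0, 1, 0) (0, 0, 1) d) = 0.
    by move: c d dc; apply: ord3P; apply: ord3P.
  by rewrite !mulr0.
elim/big_ind: _ => [|y1 y2|c _]; [exact: cone0|exact: coneD|].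
exact: coneZ.
Qed.

End closed_cone.

Section measurable_exposed.
Context {R : realType} {d : measure_display} {M : measurableType d}.
Notation V := (space3 R).

Lemma measurable_leP (f g : M -> R) :
  measurable_fun setT f -> measurable_fun setT g ->
  measurable [set w | f w <= g w].
Proof.
move=> mf mg; have := measurable_fun_ler mf mg.
by move=> /(_ measurableT [set true]); rewrite setTI; apply.
Qed.

Lemma measurable_ltP (f g : M -> R) :
  measurable_fun setT f -> measurable_fun setT g ->
  measurable [set w | f w < g w].
Proof.
move=> mf mg; have := measurable_fun_ltr mf mg.
by move=> /(_ measurableT [set true]); rewrite setTI; apply.
Qed.

Lemma measurable_coord c (p : M -> V) : measurable_fun setT p ->
  measurable_fun setT (fun w => coord c (p w)).
Proof.
move=> mp; move: c; apply: ord3P; rewrite /coord /tri /=.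
- by do 2![apply: measurableT_comp => //].
- by do 2![apply: measurableT_comp => //].
- exact: measurableT_comp.
Qed.

Lemma measurable_cone (G : finType) (v : G -> M -> V) (y : V) :
  (forall g, measurable_fun setT (v g)) ->
  measurable [set w | cone (v^~ w) y].
Proof.
move=> mv.
rewrite (_ : [set w | _] = \bigcup_N \bigcap_n \bigcup_(k in [set: {ffun G -> 'I_(N * n.+1).+1}])
    \bigcap_(c in setT) [set w |
      `|\sum_g (k g)%:R / n.+1%:R * coord c (v g w) - coord c y| <=
      (\sum_g `|coord c (v g w)|) / n.+1%:R]); last first.
  apply/seteqP; split => w /=.
    move=> /cone_gridP[N h]; exists N => // n _; have [k kP] := h n.
    by exists k => // c _; exact: kP.
  move=> [N _ h]; apply/cone_gridP; exists N => n; have [k _ kP] := h n I.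
  by exists k => c; exact: kP.
apply: bigcupT_measurable => N; apply: bigcapT_measurable => n.
apply: fin_bigcup_measurable => // k _; apply: fin_bigcap_measurable => // c _.
apply: measurable_leP.
  apply: measurableT_comp; first exact: normr_measurable.
  apply: measurable_funB => //; apply: measurable_sum => g.
  by apply: measurable_funM => //; exact: measurable_coord.
apply: measurable_funM => //; apply: measurable_sum => g.
apply: measurableT_comp; first exact: normr_measurable.
exact: measurable_coord.
Qed.

Lemma measurable_full_cone (G : finType) (v : G -> M -> V) :
  (forall g, measurable_fun setT (v g)) ->
  measurable [set w | full_cone (v^~ w)].
Proof.
move=> mv.
rewrite (_ : [set w | _] =
    \bigcap_(s in setT) [set w | cone (v^~ w) (signed_axis R s)]).
  by apply: fin_bigcap_measurable => // s _; exact: measurable_cone.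
apply/seteqP; split => w /= => [/full_cone_axes h s _|h]; first exact: h.
by apply/full_cone_axes => s; exact: h.
Qed.

Lemma measurable_funB3 (p q : M -> V) : measurable_fun setT p ->
  measurable_fun setT q -> measurable_fun setT (fun w => p w - q w).
Proof.
move=> mp mq.
rewrite (_ : (fun w => _) = (fun w => ((coord ord0 (p w) - coord ord0 (q w),
    coord (lift ord0 ord0) (p w) - coord (lift ord0 ord0) (q w)),
    coord ord_max (p w) - coord ord_max (q w))))//.
by do 2?[apply: measurable_fun_pair]; apply: measurable_funB;
  exact: measurable_coord.
Qed.

Lemma measurable_exposed (I : finType) (F : 'I_3 -> M -> V) (J : {set I})
    (p : I -> M -> V) :
  (forall k, measurable_fun setT (F k)) ->
  (forall i, measurable_fun setT (p i)) ->
  measurable [set w | exposed (F^~ w) J (p^~ w)].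
Proof.
move=> mF mp.
rewrite (_ : [set w | _] = \bigcap_(i in [set` J])
    ~` [set w | full_cone (fun g => gens (F^~ w) J (p^~ w) (p i w) g)])//.
apply: fin_bigcap_measurable => // i _; apply: measurableC.
apply: measurable_full_cone => -[k|j] /=; first exact: measurable_funB3.
by case: (j \in J) => //; exact: measurable_funB3.
Qed.

End measurable_exposed.

(** * Volumes *)

Section product_sigma_finite.
Context d1 d2 (T1 : measurableType d1) (T2 : measurableType d2) (R : realType).
Variables (m1 : {sigma_finite_measure set T1 -> \bar R})
  (m2 : {sigma_finite_measure set T2 -> \bar R}).

(** A new name for the product measure, able to carry a sigma-finite instance: products are iterated
    below, both for the volume and for the three copies of the probability space. *)
Definition prod_measure := product_measure1 m1 m2.

HB.instance Definition _ := Measure.on prod_measure.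

Let prod_measure_sigma_finite : sigma_finite setT prod_measure.
Proof.
have /sigma_finiteP[F [TF ndF Foo]] := sigma_finiteT m1.
have /sigma_finiteP[G [TG ndG Goo]] := sigma_finiteT m2.
exists (fun n => F n `*` G n) => [|k].
  rewrite -setXTT TF TG predeqE => -[x y]; split=> [[/= [n _ Fx] [k _ Gy]]|].
    exists (maxn n k) => //; split.
    - by move: x Fx; exact/subsetPset/ndF/leq_maxl.
    - by move: y Gy; exact/subsetPset/ndG/leq_maxr.
  by move=> [n _ [? ?]]; split; exists n.
have [mF Fk] := Foo k; have [mG Gk] := Goo k.
split; first exact: measurableX.
by rewrite /prod_measure product_measure1E// lte_mul_pinfty// ge0_fin_numE.
Qed.

HB.instance Definition _ := Measure_isSigmaFinite.Build _ _ _ prod_measure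
  prod_measure_sigma_finite.

End product_sigma_finite.

(* [lebesgue_measure] and [volume] are repackaged over the canonical measurable
   structures of [R] and [space3 R], whose displays differ from those used by
   [lebesgue_measure]. *)
Definition leb (R : realType) : set R -> \bar R := lebesgue_measure.
Arguments leb R : clear implicits.

Section leb_measure.
Variable R : realType.

Let leb0 : leb R set0 = 0%E. Proof. exact: (measure0 lebesgue_measure). Qed.

Let leb_ge0 A : (0 <= leb R A)%E.
Proof. exact: (measure_ge0 lebesgue_measure). Qed.

Let leb_sigma_additive : semi_sigma_additive (leb R).
Proof. exact: (@measure_semi_sigma_additive _ _ _ lebesgue_measure). Qed.

HB.instance Definition _ := isMeasure.Build _ _ _ (leb R)
  leb0 leb_ge0 leb_sigma_additive.

Let leb_sigma_finite : sigma_finite setT (leb R).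
Proof. exact: (sigma_finiteT lebesgue_measure). Qed.

HB.instance Definition _ := Measure_isSigmaFinite.Build _ _ _ (leb R)
  leb_sigma_finite.

End leb_measure.

Definition vol2 (R : realType) : {sigma_finite_measure set (R * R)%type -> \bar R} :=
  prod_measure (leb R) (leb R).

Definition vol3 (R : realType) : {sigma_finite_measure set (space3 R) -> \bar R} :=
  prod_measure (vol2 R) (leb R).

(** Change of variables for a push-forward known only by its values on measurable sets. With [phi]
    the identity, it moves integrals between two packagings of the same measure. *)
Lemma integral_transfer d d' (T : measurableType d) (T' : measurableType d')
    (R : realType) (m : {measure set T -> \bar R}) (m' : {measure set T' -> \bar R})
    (phi : T -> T') (f : T' -> \bar R) :
  measurable_fun setT phi -> measurable_fun setT f -> (forall x, 0 <= f x)%E ->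
  (forall A, measurable A -> m' A = m (phi @^-1` A)) ->
  (\int[m']_x f x = \int[m]_x f (phi x))%E.
Proof.
move=> mphi mf f0 mE.
rewrite -[RHS](ge0_integral_pushforward mphi m (D := setT))//.
by apply: eq_measure_integral => A mA _; rewrite mE.
Qed.

Section volume_vol3.
Variable R : realType.

Lemma integral_leb (f : R -> \bar R) :
  measurable_fun setT f -> (forall x, 0 <= f x)%E ->
  (\int[lebesgue_measure]_x f x = \int[leb R]_x f x)%E.
Proof.
move=> mf f0.
exact: (@integral_transfer _ _ R (measurableTypeR R) R (leb R) lebesgue_measure id).
Qed.

Let area_vol2 (A : set (R * R)%type) : measurable A ->
  (lebesgue_measure \x lebesgue_measure)%E A = vol2 R A.
Proof.
move=> mA; rewrite /product_measure1 integral_leb//.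
exact: (measurable_fun_xsection (leb R) mA).
Qed.

Lemma volumeE (S : set (space3 R)) : measurable S -> volume S = vol3 R S.
Proof.
move=> mS.
have mf := measurable_fun_xsection (leb R) mS.
have mid : measurable_fun setT
    (id : R * R -> measurableTypeR R * measurableTypeR R)%type by [].
have := @integral_transfer _ _ (R * R)%type
  (measurableTypeR R * measurableTypeR R)%type R (vol2 R) _ id _ mid mf.
move=> /(_ _ (fun x => measure_ge0 (leb R) _)).
move=> /(_ _ area_vol2).
by [].
Qed.

End volume_vol3.

Section lebesgue_affine.
Variable R : realType.
Local Open Scope ereal_scope.

Lemma measurable_affine (a b : R) :
  measurable_fun setT (fun t : R => a * t + b)%R.
Proof. by apply: measurable_funD => //; exact: measurable_funM. Qed.

(** By uniqueness of Lebesgue measure: the push-forward scaled by [|a|] gives half-open intervals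
    their length. *)
Lemma lebesgue_measure_affine (a b : R) (A : set R) : a != 0%R ->
  measurable A ->
  lebesgue_measure ((fun t => a * t + b)%R @^-1` A) = (`|a|^-1)%:E * lebesgue_measure A.
Proof.
move=> a0 mA; have na0 : (0 < `|a|)%R by rewrite normr_gt0.
pose f : measurableTypeR R -> measurableTypeR R := (fun t => a * t + b)%R.
have mf : measurable_fun setT f := measurable_affine a b.
pose k : {nonneg R} := NngNum (ltW na0).
pose m := mscale k (pushforward (lebesgue_measure) f).
have -> : lebesgue_measure A = m mf A.
  apply: lebesgue_measure_unique => // X /ocitvP[->|[[x y] /= xy ->]].
    by rewrite !measure0.
  rewrite /m /mscale /= /pushforward.
  have [a1|a1] := ltP 0%R a.
    rewrite (_ : f @^-1` _ = `](x - b) / a, (y - b) / a]%classic)%R; last first.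
      apply/seteqP; split => t /=;
        by rewrite !in_itv/= ltr_pdivrMr// ler_pdivlMr// ltrBlDr lerBrDr mulrC.
    have xy' : ((x - b) / a < (y - b) / a)%R by rewrite ltr_pM2r ?invr_gt0// ltrD2r.
    rewrite !lebesgue_measure_itv/= !lte_fin xy xy' -!EFinB -EFinM gtr0_norm//.
    by congr _%:E; field.
  have {}a1 : (a < 0)%R by rewrite lt_neqAle a0.
  (* A negative slope reverses the interval, so the closed end changes sides. *)
  rewrite (_ : f @^-1` _ = `[(y - b) / a, (x - b) / a[%classic)%R; last first.
    apply/seteqP; split => t /=;
      rewrite !in_itv/= ler_ndivrMr// ltr_ndivlMr// ltrBlDr lerBrDr mulrC;
      by rewrite andbC.
  have xy' : ((y - b) / a < (x - b) / a)%R.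
    by rewrite ltr_nM2r ?invr_lt0// ltrD2r.
  rewrite !lebesgue_measure_itv/= !lte_fin xy xy' -!EFinB -EFinM ltr0_norm//.
  by congr _%:E; field.
rewrite /m /mscale /= /pushforward muleA -EFinM mulVf ?gt_eqF// mul1e.
by [].
Qed.

Lemma leb_affine (a b : R) (A : set R) : a != 0%R -> measurable A ->
  leb R ((fun t => a * t + b)%R @^-1` A) = (`|a|^-1)%:E * leb R A.
Proof. exact: lebesgue_measure_affine. Qed.

Lemma integral_affine (a b : R) (f : R -> \bar R) : a != 0%R ->
  measurable_fun setT f -> (forall x, 0 <= f x) ->
  \int[leb R]_x f (a * x + b)%R = (`|a|^-1)%:E * \int[leb R]_x f x.
Proof.
move=> a0 mf f0; have na0 : (0 <= `|a|^-1)%R by rewrite invr_ge0.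
rewrite -(ge0_integral_mscale _ measurableT (NngNum na0))//.
apply/esym; apply: integral_transfer => //; first exact: measurable_affine.
by move=> A mA; rewrite /mscale /= leb_affine.
Qed.

End lebesgue_affine.

Section product_sections.
Context d1 d2 (T1 : measurableType d1) (T2 : measurableType d2) (R : realType).
Variables (m1 : {sigma_finite_measure set T1 -> \bar R})
  (m2 : {sigma_finite_measure set T2 -> \bar R}).
Local Open Scope ereal_scope.

Lemma product_measure_ysection (A : set (T1 * T2)) : measurable A ->
  prod_measure m1 m2 A = \int[m2]_y m1 (ysection A y).
Proof.
move=> mA; transitivity (\int[prod_measure m1 m2]_z (\1_A z)%:E).
  by rewrite integral_indic// setIT.
rewrite (fubini_tonelli2 (fun z => (\1_A z)%:E)).
- apply: eq_integral => y _; transitivity (\int[m1]_x (\1_(ysection A y) x)%:E).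
    by apply: eq_integral => x _; rewrite !indicE mem_ysection.
  by rewrite integral_indic ?setIT//; exact: measurable_ysection.
- by apply/measurable_EFinP.
- by move=> z; rewrite lee_fin.
Qed.

End product_sections.

Section volume_sections.
Variable R : realType.
Notation V := (space3 R).
Local Open Scope ereal_scope.

Lemma vol3_ysection (S : set V) : measurable S ->
  vol3 R S = \int[leb R]_z vol2 R (ysection S z).
Proof. exact: product_measure_ysection. Qed.

Lemma vol2_ysection (A : set (R * R)%type) : measurable A ->
  vol2 R A = \int[leb R]_y leb R (ysection A y).
Proof. exact: product_measure_ysection. Qed.

Lemma vol2_xsection (A : set (R * R)%type) :
  vol2 R A = \int[leb R]_x leb R (xsection A x).
Proof. by []. Qed.

Lemma volume_zE (S : set V) :
  vol3 R S = \int[vol2 R]_q leb R [set z | S (q, z)].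
Proof.
apply: eq_integral => q _ /=; congr (leb R _).
by rewrite xsectionE.
Qed.

Lemma volume_yE (S : set V) : measurable S ->
  vol3 R S = \int[leb R]_z \int[leb R]_x leb R [set y | S ((x, y), z)].
Proof.
move=> mS; rewrite (vol3_ysection mS).
apply: eq_integral => z _; rewrite vol2_xsection; apply: eq_integral => x _.
congr (leb R _).
by rewrite xsectionE ysectionE.
Qed.

Lemma volume_xE (S : set V) : measurable S ->
  vol3 R S = \int[leb R]_z \int[leb R]_y leb R [set x | S ((x, y), z)].
Proof.
move=> mS; rewrite (vol3_ysection mS).
apply: eq_integral => z _; rewrite vol2_ysection; last first.
  exact: measurable_ysection.
apply: eq_integral => y _; congr (leb R _).
by rewrite !ysectionE.
Qed.

Lemma measurable_fiber_z (S : set V) q : measurable S ->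
  measurable [set z | S (q, z)].
Proof.
move=> mS; rewrite (_ : [set z | _] = xsection S q).
  exact: measurable_xsection.
by rewrite xsectionE.
Qed.

Lemma measurable_fiber_xy (S : set V) z : measurable S ->
  measurable [set q | S (q, z)].
Proof.
move=> mS; rewrite (_ : [set q | _] = ysection S z).
  exact: measurable_ysection.
by rewrite !ysectionE.
Qed.

Lemma measurable_fiber_y (S : set V) x z : measurable S ->
  measurable [set y | S ((x, y), z)].
Proof.
move=> /measurable_fiber_xy mS.
rewrite (_ : [set y | _] = xsection [set q | S (q, z)] x).
  by apply: measurable_xsection; exact: mS.
by rewrite xsectionE.
Qed.

Lemma measurable_fiber_x (S : set V) y z : measurable S ->
  measurable [set x | S ((x, y), z)].
Proof.
move=> /measurable_fiber_xy mS.
rewrite (_ : [set y | _] = ysection [set q | S (q, z)] y).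
  by apply: measurable_ysection; exact: mS.
by rewrite !ysectionE.
Qed.

Lemma measurable_fun_volume_x (S : set V) z : measurable S ->
  measurable_fun setT (fun y => leb R [set x | S ((x, y), z)]).
Proof.
move=> mS.
have := measurable_fun_ysection (leb R) (measurable_fiber_xy z mS).
congr measurable_fun; apply/funext => y /=; congr (leb R _).
by rewrite !ysectionE.
Qed.

Lemma measurable_fun_volume_y (S : set V) z : measurable S ->
  measurable_fun setT (fun x => leb R [set y | S ((x, y), z)]).
Proof.
move=> mS.
have := measurable_fun_xsection (leb R) (measurable_fiber_xy z mS).
congr measurable_fun; apply/funext => y /=; congr (leb R _).
by rewrite xsectionE.
Qed.

Lemma measurable_fun_volume_xy (S : set V) : measurable S ->
  measurable_fun setT (fun z => vol2 R [set q | S (q, z)]).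
Proof.
move=> mS; have := measurable_fun_ysection (vol2 R) mS.
congr measurable_fun; apply/funext => z /=; congr (vol2 R _).
by rewrite !ysectionE.
Qed.

Lemma measurable_fun_volume_z (S : set V) : measurable S ->
  measurable_fun setT (fun q => leb R [set z | S (q, z)]).
Proof.
move=> mS; have := measurable_fun_xsection (leb R) mS.
congr measurable_fun; apply/funext => q /=; congr (leb R _).
by rewrite xsectionE.
Qed.

(** The map changes one coordinate only, and on each line in that direction it is affine of constant
    slope [a]; Tonelli's theorem reduces the claim to the line. The same holds for the two other
    coordinates. *)
Lemma volume_affine_z (a : R) (b : R * R -> R) (S : set V) : a != 0%R ->
  measurable S -> measurable_fun setT b ->
  vol3 R ((fun p => (p.1, a * p.2 + b p.1)%R) @^-1` S) = (`|a|^-1)%:E * vol3 R S.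
Proof.
move=> a0 mS mb; rewrite !volume_zE.
transitivity (\int[vol2 R]_q ((`|a|^-1)%:E * leb R [set z | S (q, z)])).
  apply: eq_integral => q _.
  exact: (leb_affine (b q) a0 (measurable_fiber_z q mS)).
rewrite ge0_integralZl_EFin ?invr_ge0//.
exact: measurable_fun_volume_z.
Qed.

Lemma volume_affine_y (a : R) (b : R -> R -> R) (S : set V) : a != 0%R ->
  measurable S ->
  measurable_fun setT (fun p : V => (p.1.1, a * p.1.2 + b p.1.1 p.2, p.2)%R) ->
  vol3 R ((fun p => (p.1.1, a * p.1.2 + b p.1.1 p.2, p.2)%R) @^-1` S) =
  (`|a|^-1)%:E * vol3 R S.
Proof.
move=> a0 mS mb; rewrite !volume_yE//; last first.
  by rewrite -[X in measurable X]setTI; exact: mb.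
transitivity (\int[leb R]_z ((`|a|^-1)%:E *
    \int[leb R]_x leb R [set y | S ((x, y), z)])).
  apply: eq_integral => z _; rewrite -ge0_integralZl_EFin ?invr_ge0//; last first.
    exact: measurable_fun_volume_y.
  apply: eq_integral => x _.
  exact: (leb_affine (b x z) a0 (measurable_fiber_y x z mS)).
rewrite ge0_integralZl_EFin ?invr_ge0//.
  by move=> z _; exact: integral_ge0.
have := measurable_fun_volume_xy mS.
congr measurable_fun; apply/funext => z; apply: eq_integral => x _.
congr (leb R _).
by rewrite xsectionE.
Qed.

Lemma volume_affine_x (a : R) (b : R -> R -> R) (S : set V) : a != 0%R ->
  measurable S ->
  measurable_fun setT (fun p : V => (a * p.1.1 + b p.1.2 p.2, p.1.2, p.2)%R) ->
  vol3 R ((fun p => (a * p.1.1 + b p.1.2 p.2, p.1.2, p.2)%R) @^-1` S) =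
  (`|a|^-1)%:E * vol3 R S.
Proof.
move=> a0 mS mb; rewrite !volume_xE//; last first.
  by rewrite -[X in measurable X]setTI; exact: mb.
transitivity (\int[leb R]_z ((`|a|^-1)%:E *
    \int[leb R]_y leb R [set x | S ((x, y), z)])).
  apply: eq_integral => z _; rewrite -ge0_integralZl_EFin ?invr_ge0//; last first.
    exact: measurable_fun_volume_x.
  apply: eq_integral => y _.
  exact: (leb_affine (b y z) a0 (measurable_fiber_x y z mS)).
rewrite ge0_integralZl_EFin ?invr_ge0//.
  by move=> z _; exact: integral_ge0.
have := measurable_fun_volume_xy mS.
congr measurable_fun; apply/funext => z; rewrite vol2_ysection.
  apply: eq_integral => y _; congr (leb R _).
  by rewrite !ysectionE.
exact: measurable_fiber_xy.
Qed.

End volume_sections.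

(** * Beta integrals and the Dirichlet integral over the tetrahedron *)

Section dirichlet.
Variable R : realType.
Notation V := (space3 R).

(** Extended by 0 outside []0, s[], so that iterated integrals run over the whole line. *)
Definition beta_integrand (s : R) (k m : nat) (x : R) : R :=
  if (0 < x) && (x < s) then x ^+ k * (s - x) ^+ m else 0.

Lemma beta_integrand_ge0 s k m x : 0 <= beta_integrand s k m x.
Proof.
rewrite /beta_integrand; case: ifPn => // /andP[x0 xs].
by rewrite mulr_ge0// exprn_ge0// ?subr_ge0 ltW.
Qed.

Lemma measurable_beta_integrand s k m :
  measurable_fun setT (beta_integrand s k m).
Proof.
apply: measurable_fun_ifT => //.
- by apply: measurable_and; exact: measurable_fun_ltr.
- by apply: measurable_funM; apply: measurable_funX => //; exact: measurable_funB.
Qed.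

Lemma integral_beta1 k m :
  (\int[leb R]_x (beta_integrand 1 k m x)%:E)%E =
  ((k`! * m`!)%:R / (k + m).+1`!%:R)%:E.
Proof.
rewrite -integral_leb//; last 2 first.
- by apply/measurable_EFinP; exact: measurable_beta_integrand.
- by move=> x; rewrite lee_fin beta_integrand_ge0.
rewrite -beta_fun_fact EFin_beta_fun /=.
transitivity (\int[@lebesgue_measure R]_(x in `]0%R, 1%R[)
    (@XMonemX R k m x)%:E)%E.
  rewrite [RHS]integral_mkcond; apply: eq_integral => x _.
  rewrite /beta_integrand patchE mem_setE in_itv /=.
  by case: ifPn.
rewrite -(@integral_itv_bndoo _ 0 1 _ true false); last first.
  by apply/measurable_EFinP; apply: measurable_funTS; exact: measurable_XMonemX.
rewrite [LHS]integral_mkcond; apply: eq_integral => x _.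
by rewrite !patchE; case: ifPn.
Qed.

Lemma integral_beta s k m : 0 < s ->
  (\int[leb R]_x (beta_integrand s k m x)%:E)%E =
  ((k`! * m`!)%:R / (k + m).+1`!%:R * s ^+ (k + m).+1)%:E.
Proof.
move=> s0; have sn0 : s != 0 by rewrite gt_eqF.
have mb := measurable_beta_integrand.
have bt t : beta_integrand s k m (s * t + 0) =
    s ^+ (k + m) * beta_integrand 1 k m t.
  rewrite /beta_integrand addr0 pmulr_rgt0// gtr_pMr//.
  case: ifPn => _; last by rewrite mulr0.
  by rewrite -{2}[s]mulr1 -mulrBr !exprMn exprD mulrACA.
have H : (\int[leb R]_x (beta_integrand s k m (s * x + 0))%:E =
    (s^-1)%:E * \int[leb R]_x (beta_integrand s k m x)%:E)%E.
  rewrite (@integral_affine R s 0 (EFin \o beta_integrand s k m))//.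
  - by rewrite gtr0_norm.
  - by apply/measurable_EFinP.
  - by move=> x; rewrite lee_fin beta_integrand_ge0.
transitivity (s%:E * ((s^-1)%:E * \int[leb R]_x (beta_integrand s k m x)%:E))%E.
  by rewrite muleA -EFinM divff// mul1e.
rewrite -H.
under eq_integral do rewrite bt EFinM.
rewrite ge0_integralZl_EFin//; last 3 first.
- by move=> x _; rewrite lee_fin beta_integrand_ge0.
- by apply/measurable_EFinP.
- by rewrite exprn_ge0// ltW.
rewrite integral_beta1 -!EFinM; congr _%:E; rewrite exprS. ring.
Qed.

Lemma integral_vol3 (f : V -> \bar R) : measurable_fun setT f ->
  (forall p, 0 <= f p)%E ->
  (\int[vol3 R]_p f p =
   \int[leb R]_z \int[leb R]_y \int[leb R]_x f ((x, y), z))%E.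
Proof.
move=> mf f0; rewrite [LHS](@fubini_tonelli2 _ _ _ _ R (vol2 R) (leb R) f)//.
apply: eq_integral => z _; rewrite /fubini_G.
rewrite [LHS](@fubini_tonelli2 _ _ _ _ R (leb R) (leb R) (fun q => f (q, z)))//.
exact: (measurableT_comp mf (pair2_measurable z)).
Qed.

(** The bases are bd and ad, the volumes of the two subtetrahedra below [p]. *)
Definition dirichlet_integrand (k m : nat) (p : V) : R :=
  (p.1.1 * (p.2 / 6)) ^+ k * (bary_a p * (p.2 / 6)) ^+ m.

Lemma measurable_bary_a : measurable_fun setT (@bary_a R).
Proof.
have m1 := @measurable_coord R _ V ord0 id (@measurable_id _ _ _).
have m2 := @measurable_coord R _ V (lift ord0 ord0) id (@measurable_id _ _ _).
have m3 := @measurable_coord R _ V ord_max id (@measurable_id _ _ _).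
apply: measurable_funB; last exact: measurable_funM.
by apply: measurable_funB => //; exact: measurable_funB.
Qed.

Lemma measurable_open_tetra : measurable (@open_tetra R).
Proof.
rewrite (_ : @open_tetra R = [set p | 0 < p.1.1] `&` [set p | 0 < p.1.2] `&`
    [set p | 0 < p.2] `&` [set p | 0 < bary_a p]); last first.
  by apply/seteqP; split => p [] => [? ? ? ?|[[? ?] ?] ?].
have m1 := @measurable_coord R _ V ord0 id (@measurable_id _ _ _).
have m2 := @measurable_coord R _ V (lift ord0 ord0) id (@measurable_id _ _ _).
have m3 := @measurable_coord R _ V ord_max id (@measurable_id _ _ _).
have ma := measurable_bary_a.
by do 3?[apply: measurableI]; exact: measurable_ltP.
Qed.

Lemma measurable_dirichlet_integrand k m :
  measurable_fun setT (dirichlet_integrand k m).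
Proof.
have m1 := @measurable_coord R _ V ord0 id (@measurable_id _ _ _).
have m3 := @measurable_coord R _ V ord_max id (@measurable_id _ _ _).
apply: measurable_funM; apply: measurable_funX; apply: measurable_funM => //.
- exact: measurable_funM.
- exact: measurable_bary_a.
- exact: measurable_funM.
Qed.

Lemma dirichlet_integrand_ge0 k m p : open_tetra p ->
  0 <= dirichlet_integrand k m p.
Proof.
by move=> [p1 p2 p3 p4]; rewrite mulr_ge0// exprn_ge0// mulr_ge0 ?divr_ge0// ltW.
Qed.

(** Three successive beta integrals, with [N = k + m]: the one in x gives [c1] and the power [N + 1]
    of the remaining length, the one in y gives [c2] and the power [N + 2], and the last one runs
    over []0, 6[]. *)
Lemma dirichlet_integral k m :
  (\int[vol3 R]_(p in @open_tetra R) (dirichlet_integrand k m p)%:E)%E =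
  (6 * (k`! * m`! * (k + m)`!)%:R / (2 * (k + m) + 3)`!%:R)%:E.
Proof.
set N := (k + m)%N.
have fn0 n : n`!%:R != 0 :> R by rewrite pnatr_eq0 -lt0n fact_gt0.
rewrite [LHS]integral_mkcond integral_vol3; last 2 first.
- apply/(measurable_restrictT _ _).1 => //; first exact: measurable_open_tetra.
  by apply/measurable_EFinP; apply: measurable_funTS;
    exact: measurable_dirichlet_integrand.
- move=> p; rewrite patchE; case: ifPn => // /set_mem pT.
  by rewrite lee_fin dirichlet_integrand_ge0.
pose c1 : R := (k`! * m`!)%:R / N.+1`!%:R.
have c10 : 0 <= c1 by rewrite divr_ge0.
have Ex y z : (\int[leb R]_x ((EFin \o dirichlet_integrand k m) \_ (@open_tetra R))
      ((x, y), z) =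
    (if 0 < z then c1 * (z / 6) ^+ N * beta_integrand (1 - z / 6) 0 N.+1 y
     else 0)%:E)%E.
  have [z0|z0] := ltP 0 z; last first.
    rewrite integral0_eq// => x _; rewrite patchE; case: ifPn => // /set_mem[_ _ + _].
    by rewrite /= ltNge z0.
  rewrite /beta_integrand; have [y0|y0] /= := ltP 0 y; last first.
    rewrite mulr0 integral0_eq// => x _; rewrite patchE; case: ifPn => // /set_mem[_ + _ _].
    by rewrite /= ltNge y0.
  have [ys|ys] := ltP y (1 - z / 6); last first.
    rewrite mulr0 integral0_eq// => x _; rewrite patchE; case: ifPn => // /set_mem[x0 _ _].
    by rewrite /bary_a /= in x0 * => a0; exfalso; lra.
  transitivity (\int[leb R]_x (((z / 6) ^+ N)%:E *
      (beta_integrand (1 - z / 6 - y) k m x)%:E))%E.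
    apply: eq_integral => x _; rewrite patchE /beta_integrand -EFinM.
    have -> : (((x, y), z) \in @open_tetra R) = (0 < x) && (x < 1 - z / 6 - y).
      apply/idP/idP => [/set_mem[]|/andP[x0 xs]].
        by rewrite /bary_a /= => -> _ _ a0; lra.
      by apply/mem_set; split; rewrite /bary_a //=; lra.
    case: ifPn => _; last by rewrite mulr0.
    rewrite /= /dirichlet_integrand /bary_a /=; congr _%:E.
    have -> : 1 - x - y - z / 6 = 1 - z / 6 - y - x by ring.
    by move: (z / 6) => w; rewrite /N exprD !exprMn; ring.
  rewrite ge0_integralZl_EFin//; last 3 first.
  - by move=> x _; rewrite lee_fin beta_integrand_ge0.
  - by apply/measurable_EFinP; exact: measurable_beta_integrand.
  - by rewrite exprn_ge0// divr_ge0// ltW.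
  rewrite integral_beta ?subr_gt0//; congr _%:E.
  by rewrite expr0 mul1r /c1; ring.
under eq_integral => z _ do under eq_integral => y _ do rewrite Ex.
pose c2 : R := N.+1`!%:R / N.+2`!%:R.
have c20 : 0 <= c2 by rewrite divr_ge0.
(* Writing [1 - z / 6] as [(6 - z) / 6] takes out [6 ^- (2 * N + 2)]; the integral in z carries
   [6 ^+ (2 * N + 3)], which leaves the factor 6 of the result. *)
pose h z : R := c1 * c2 * (6 ^- (2 * N + 2) * beta_integrand 6 N N.+2 z).
have Ey z : (\int[leb R]_y
    (if 0 < z then c1 * (z / 6) ^+ N * beta_integrand (1 - z / 6) 0 N.+1 y
     else 0)%:E = (h z)%:E)%E.
  rewrite /h /(beta_integrand 6); have [z0|z0] /= := ltP 0 z; last first.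
    by rewrite !mulr0 integral0_eq.
  have [z6|z6] := ltP z 6; last first.
    rewrite !mulr0 integral0_eq// => y _; rewrite /beta_integrand.
    by case: ifPn; rewrite ?mulr0// => /andP[? ?]; exfalso; lra.
  under eq_integral do rewrite EFinM.
  rewrite ge0_integralZl_EFin//; last 3 first.
  - by move=> y _; rewrite lee_fin beta_integrand_ge0.
  - by apply/measurable_EFinP; exact: measurable_beta_integrand.
  - by rewrite mulr_ge0// exprn_ge0// divr_ge0// ltW.
  rewrite integral_beta; last by lra.
  rewrite -EFinM add0n fact0 mul1n /c2; congr _%:E.
  have -> : 1 - z / 6 = (6 - z) / 6 by field.
  rewrite !expr_div_n.
  have -> : (6 : R) ^- (2 * N + 2) = 6 ^- N * 6 ^- N.+2.
    by rewrite -invfM -exprD; congr (_ ^- _); lia.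
  by ring.
under eq_integral do rewrite Ey /h EFinM.
rewrite ge0_integralZl_EFin//; last 3 first.
- by move=> z _; rewrite lee_fin mulr_ge0 ?invr_ge0 ?exprn_ge0// beta_integrand_ge0.
- apply/measurable_EFinP; apply: measurable_funM => //.
  exact: measurable_beta_integrand.
- exact: mulr_ge0.
under eq_integral do rewrite EFinM.
rewrite ge0_integralZl_EFin//; last 2 first.
- by move=> z _; rewrite lee_fin beta_integrand_ge0.
- by apply/measurable_EFinP; exact: measurable_beta_integrand.
rewrite integral_beta// -!EFinM /c1 /c2; congr _%:E.
have -> : (2 * N + 3 = (N + N.+2).+1)%N by lia.
have -> : (6 : R) ^+ (N + N.+2).+1 = 6 * 6 ^+ (2 * N + 2).
  by rewrite -exprS; congr (_ ^+ _); lia.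
have s6 : (6 : R) ^+ (2 * N + 2) != 0 by rewrite expf_neq0.
have alg (a b c e x y : R) : a != 0 -> b != 0 -> c != 0 -> e != 0 ->
    x / b * (b / c) * (a^-1 * (y * c / e * (6 * a))) = 6 * (x * y) / e.
  by move=> a0 b0 c0 e0; field; rewrite a0 b0 c0 e0.
by rewrite (natrM _ (k`! * m`!) N`!) (natrM _ N`! N.+2`!); apply: alg.
Qed.

(** The Dirichlet integral with both exponents 0, that is [6 / 3! = 1]. *)
Lemma vol3_open_tetra : vol3 R (@open_tetra R) = 1%E.
Proof.
have := dirichlet_integral 0 0.
rewrite !muln0 !add0n !fact0 !muln1 /dirichlet_integrand.
under eq_integral do rewrite !expr0 mulr1.
rewrite integral_cst; last exact: measurable_open_tetra.
rewrite mul1e => ->; congr _%:E.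
by rewrite (_ : 3`! = 6)%N// mulr1 divff.
Qed.

End dirichlet.

(** * The tetrahedron by inequalities, and its uniform law *)

Section tetrahedron_volume.
Variable R : realType.
Notation V := (space3 R).

Definition closed_tetra : set V :=
  [set p | [/\ 0 <= p.1.1, 0 <= p.1.2, 0 <= p.2 & 0 <= bary_a p]].

(** The origin, which is the vertex [A], takes the remaining weight: mix [u] and [v] in the ratio of
    [s] to [t], then shrink towards 0. *)
Lemma segment_closed_cone2 (K : set V) (u v : V) (s t : R) :
  segment_closed K -> K 0 -> K u -> K v -> 0 <= s -> 0 <= t -> s + t <= 1 ->
  K (s *: u + t *: v).
Proof.
move=> cK K0 Ku Kv s0 t0 st.
have [st0|st0] := eqVneq (s + t) 0.
  have [-> ->] : s = 0 /\ t = 0 by lra.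
  by rewrite !scale0r addr0.
have st_gt0 : 0 < s + t by rewrite lt_neqAle eq_sym st0 addr_ge0.
have := cK _ _ _ (addr_ge0 s0 t0) st
  (cK _ _ (s / (s + t)) (divr_ge0 s0 (addr_ge0 s0 t0)) _ Ku Kv) K0.
rewrite scaler0 addr0 scalerDr !scalerA ler_pdivrMr// mul1r lerDl => /(_ t0).
have -> : (s + t) * (s / (s + t)) = s by field.
by have -> : (s + t) * (1 - s / (s + t)) = t by field.
Qed.

Lemma tetrahedronE : tetrahedron R = closed_tetra.
Proof.
apply/seteqP; split.
  apply: convex_hull_sub => [p q t t0 t1 [p1 p2 p3 p4] [q1 q2 q3 q4]|].
    have t'0 : 0 <= 1 - t by rewrite subr_ge0.
    have ba : bary_a (t *: p + (1 - t) *: q) = t * bary_a p + (1 - t) * bary_a q.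
      by rewrite /bary_a /= /GRing.scale /=; ring.
    by split; rewrite ?ba; apply: addr_ge0; exact: mulr_ge0.
  by move=> _ [[[->|->]|->]|->]; split; rewrite /bary_a /=; lra.
move=> p [p1 p2 p3 p4]; rewrite /tetrahedron; set K := convex_hull _.
have cK : segment_closed K by exact: convex_hull_segment_closed.
have KA : K 0 by apply: sub_convex_hull; do 3!left.
have KB : K (vB R) by apply: sub_convex_hull; left; left; right.
have KC : K (vC R) by apply: sub_convex_hull; left; right.
have KD : K (vD R) by apply: sub_convex_hull; right.
rewrite /bary_a in p4.
pose s := p.1.1 + p.1.2.
have s0 : 0 <= s by rewrite addr_ge0.
have [E|E] := eqVneq s 0.
  have [E1 E2] : p.1.1 = 0 /\ p.1.2 = 0 by rewrite /s in E; lra.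
  have -> : p = (p.2 / 6) *: vD R + 0 *: 0.
    by apply: prod3_eq; rewrite /= ?E1 ?E2 /GRing.scale /=; field.
  by apply: segment_closed_cone2 => //; lra.
have -> : p = s *: ((p.1.1 / s) *: vB R + (p.1.2 / s) *: vC R) +
    (p.2 / 6) *: vD R.
  by apply: prod3_eq; rewrite /= /GRing.scale /=; field.
apply: segment_closed_cone2 => //; last 2 first.
- by lra.
- by rewrite /s; lra.
apply: segment_closed_cone2 => //; try exact: divr_ge0.
by rewrite -mulrDl divff.
Qed.

Let facets : set V := [set p : V | p.1.1 = 0] `|` [set p | p.1.2 = 0] `|`
  [set p | p.2 = 0] `|` [set p | bary_a p = 0].

Lemma measurable_zero (f : V -> R) : measurable_fun setT f ->
  measurable [set p | f p = 0].
Proof.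
by move=> mf; have := mf measurableT _ (measurable_set1 0); rewrite setTI.
Qed.

Lemma vol3_facets : measurable facets /\ vol3 R facets = 0%E.
Proof.
have m1 := @measurable_coord R _ V ord0 id (@measurable_id _ _ _).
have m2 := @measurable_coord R _ V (lift ord0 ord0) id (@measurable_id _ _ _).
have m3 := @measurable_coord R _ V ord_max id (@measurable_id _ _ _).
have ma := @measurable_bary_a R.
have M1 := measurable_zero m1; have M2 := measurable_zero m2.
have M3 := measurable_zero m3; have Ma := measurable_zero ma.
have leb1 (x : R) : leb R [set x] = 0%E by exact: lebesgue_measure_set1.
have N1 : vol3 R [set p : V | p.1.1 = 0] = 0%E.
  rewrite (volume_xE M1) integral0_eq// => z _; rewrite integral0_eq// => y _.
  exact: leb1.
have N2 : vol3 R [set p : V | p.1.2 = 0] = 0%E.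
  rewrite (volume_yE M2) integral0_eq// => z _; rewrite integral0_eq// => x _.
  exact: leb1.
have N3 : vol3 R [set p : V | p.2 = 0] = 0%E.
  by rewrite volume_zE integral0_eq// => q _; exact: leb1.
have N4 : vol3 R [set p : V | bary_a p = 0] = 0%E.
  rewrite volume_zE integral0_eq// => q _ /=.
  rewrite (_ : [set z | _] = [set 6 * (1 - q.1 - q.2)])//.
  by apply/seteqP; split => z /=; rewrite /bary_a /= => h; lra.
have mf : measurable facets by do 3?[apply: measurableU => //].
have nU A B : measurable A -> measurable B -> vol3 R A = 0%E ->
    vol3 R B = 0%E -> vol3 R (A `|` B) = 0%E.
  move=> mA mB A0 B0; apply/eqP; rewrite eq_le measure_ge0 andbT.
  apply: le_trans (measureU2 _ mA mB) _.
  by rewrite [X in (X + _)%E]A0 [X in (_ + X)%E]B0 adde0.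
rewrite /facets in mf *; split; first exact: mf.
apply: (nU _ _ _ Ma _ N4); last apply: (nU _ _ _ M3 _ N3); last exact: nU.
- by do 2?[apply: measurableU => //].
- exact: measurableU.
Qed.

Lemma measurable_closed_tetra : measurable closed_tetra.
Proof.
rewrite (_ : closed_tetra = [set p | 0 <= p.1.1] `&` [set p | 0 <= p.1.2] `&`
    [set p | 0 <= p.2] `&` [set p | 0 <= bary_a p]); last first.
  by apply/seteqP; split => p [] => [? ? ? ?|[[? ?] ?] ?].
have m1 := @measurable_coord R _ V ord0 id (@measurable_id _ _ _).
have m2 := @measurable_coord R _ V (lift ord0 ord0) id (@measurable_id _ _ _).
have m3 := @measurable_coord R _ V ord_max id (@measurable_id _ _ _).
have ma := @measurable_bary_a R.
by do 3?[apply: measurableI]; exact: measurable_leP.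
Qed.

(** The two tetrahedra differ by points of the four facet planes, which are null. *)
Lemma vol3_closed_tetra (A : set V) : measurable A ->
  vol3 R (A `&` closed_tetra) = vol3 R (A `&` @open_tetra R).
Proof.
move=> mA; have [mf f0] := vol3_facets.
have mo := @measurable_open_tetra R; have mc := measurable_closed_tetra.
have mAo : measurable (A `&` @open_tetra R) by exact: measurableI.
have mAc : measurable (A `&` closed_tetra) by exact: measurableI.
apply/eqP; rewrite eq_le; apply/andP; split; last first.
  apply: le_measure; rewrite ?inE// => p [Ap [p1 p2 p3 p4]].
  by split=> //; split; exact: ltW.
apply: (@le_trans _ _ (vol3 R ((A `&` @open_tetra R) `|` facets))); last first.
  by apply: le_trans (measureU2 _ mAo mf) _; rewrite [X in (_ + X)%E]f0 adde0.
apply: le_measure; rewrite ?inE//; first exact: measurableU.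
move=> p [Ap [p1 p2 p3 p4]].
have [E|n1] := eqVneq p.1.1 0; first by right; do 3!left.
have [E|n2] := eqVneq p.1.2 0; first by right; do 2!left; right.
have [E|n3] := eqVneq p.2 0; first by right; left; right.
have [E|n4] := eqVneq (bary_a p) 0; first by right; right.
by left; split=> //; split; rewrite lt_neqAle eq_sym ?n1 ?n2 ?n3 ?n4.
Qed.

Lemma uniform_tetrahedronE (A : set V) : measurable A ->
  (volume (A `&` tetrahedron R) / volume (tetrahedron R))%E =
  vol3 R (A `&` @open_tetra R).
Proof.
move=> mA; rewrite tetrahedronE.
have mc := measurable_closed_tetra.
rewrite (volumeE (measurableI _ _ mA mc)) (volumeE mc) (vol3_closed_tetra mA).
have := @vol3_closed_tetra setT measurableT; rewrite !setTI => ->.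
by rewrite vol3_open_tetra inve1 mule1.
Qed.

End tetrahedron_volume.

(** * Affine charts of the two subtetrahedra *)

Section subtetrahedra.
Variable R : realType.
Notation V := (space3 R).
Implicit Types (u p q : V).

(* The linear map sending A, u, C, E to A, B, C, D. *)
Definition chart1 u p : V :=
  (p.1.1 / u.1.1, p.1.2 - u.1.2 / u.2 * p.2,
   6 * (p.2 / u.2 - p.1.1 / u.1.1)).

(** The affine involution exchanging [A] and [B] and fixing [C] and [D]; it turns the second
    subtetrahedron of [u] into the first one of the image of [u]. *)
Definition swapAB p : V := (bary_a p, p.1.2, p.2).

Definition chart2 u p : V := chart1 (swapAB u) (swapAB p).

Lemma swapAB_tetra u : open_tetra u -> open_tetra (swapAB u).
Proof.
move=> [u1 u2 u3 u4]; split=> //; rewrite /bary_a /= /bary_a /=.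
by rewrite !opprB; lra.
Qed.

Lemma measurable_tuple3 (d : measure_display) (M : measurableType d)
    (f g h : M -> R) : measurable_fun setT f -> measurable_fun setT g ->
  measurable_fun setT h -> measurable_fun setT (fun w => (f w, g w, h w) : V).
Proof. by move=> mf mg mh; do 2?[apply: measurable_fun_pair]. Qed.

Lemma measurable_swapAB : measurable_fun setT swapAB.
Proof.
apply: measurable_tuple3; first exact: measurable_bary_a.
- exact: (@measurable_coord R _ V (lift ord0 ord0) id).
- exact: (@measurable_coord R _ V ord_max id).
Qed.

Lemma measurable_chart1 u : measurable_fun setT (chart1 u).
Proof.
have m1 := @measurable_coord R _ V ord0 id (@measurable_id _ _ _).
have m2 := @measurable_coord R _ V (lift ord0 ord0) id (@measurable_id _ _ _).
have m3 := @measurable_coord R _ V ord_max id (@measurable_id _ _ _).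
apply: measurable_tuple3; first exact: measurable_funM.
- by apply: measurable_funB => //; exact: measurable_funM.
- apply: measurable_funM => //; apply: measurable_funB; exact: measurable_funM.
Qed.

Lemma measurable_chart2 u : measurable_fun setT (chart2 u).
Proof. exact: measurableT_comp (measurable_chart1 _) measurable_swapAB. Qed.

Lemma vol3_chart1 u (S : set V) : 0 < u.1.1 -> 0 < u.2 -> measurable S ->
  vol3 R (chart1 u @^-1` S) = ((u.1.1 * u.2 / 6)%:E * vol3 R S)%E.
Proof.
move=> u1 u3 mS.
have m1 := @measurable_coord R _ V ord0 id (@measurable_id _ _ _).
have m2 := @measurable_coord R _ V (lift ord0 ord0) id (@measurable_id _ _ _).
have m3 := @measurable_coord R _ V ord_max id (@measurable_id _ _ _).
(* The chart is a shear in y, then a dilation in x, then a dilation and shear in z, with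
   determinants 1, [1 / u.1.1] and [6 / u.2]. *)
pose fy (p : V) : V := (p.1.1, 1 * p.1.2 + - (u.1.2 / u.2 * p.2), p.2).
pose fx (p : V) : V := ((u.1.1)^-1 * p.1.1 + 0, p.1.2, p.2).
pose fz (p : V) : V := (p.1, 6 / u.2 * p.2 + - (6 * p.1.1)).
have mfy : measurable_fun setT fy.
  apply: measurable_tuple3 => //; apply: measurable_funD; first exact: measurable_funM.
  apply: measurableT_comp => //; exact: measurable_funM.
have mfx : measurable_fun setT fx.
  by apply: measurable_tuple3 => //; apply: measurable_funD => //; exact: measurable_funM.
have mfz : measurable_fun setT fz.
  apply: measurable_fun_pair => //; apply: measurable_funD; first exact: measurable_funM.
  apply: measurableT_comp => //; exact: measurable_funM.
have -> : chart1 u @^-1` S = fy @^-1` (fx @^-1` (fz @^-1` S)).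
  congr (_ @^-1` S); apply/funext => p; apply: prod3_eq => /=.
  - by rewrite addr0 mulrC.
  - by rewrite mul1r.
  - by rewrite addr0; field; rewrite !gt_eqF.
have mpre (f : V -> V) (B : set V) : measurable_fun setT f -> measurable B ->
    measurable (f @^-1` B).
  by move=> mf mB; rewrite -[X in measurable X]setTI; exact: mf.
have mS1 : measurable (fz @^-1` S) by exact: mpre.
have mS2 : measurable (fx @^-1` (fz @^-1` S)) by exact: mpre.
have u1n : (u.1.1)^-1 != 0 by rewrite invr_neq0// gt_eqF.
rewrite (@volume_affine_y R 1 (fun _ z => - (u.1.2 / u.2 * z)) _ (oner_neq0 R) mS2 mfy).
rewrite normr1 invr1 mul1e (@volume_affine_x R _ (fun _ _ => 0) _ u1n mS1 mfx).
have mb : measurable_fun setT (fun q : R * R => - (6 * q.1)).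
  by apply: measurableT_comp => //; exact: measurable_funM.
have n6 : 6 / u.2 != 0 by rewrite mulf_neq0// invr_neq0// gt_eqF.
rewrite (volume_affine_z n6 mS mb).
rewrite muleA -EFinM !gtr0_norm ?invr_gt0 ?divr_gt0//; by rewrite invrK invf_div mulrA.
Qed.

Lemma vol3_swapAB (S : set V) : measurable S ->
  vol3 R (swapAB @^-1` S) = vol3 R S.
Proof.
move=> mS.
have -> : swapAB = (fun p => (-1 * p.1.1 + (1 - p.1.2 - p.2 / 6), p.1.2, p.2)).
  by apply/funext => p; apply: prod3_eq => //=; rewrite /bary_a; ring.
rewrite (@volume_affine_x R (-1) (fun y z => 1 - y - z / 6))//.
- by rewrite normrN1 invr1 mul1e.
- have := measurable_swapAB; congr measurable_fun; apply/funext => p.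
  by apply: prod3_eq => //=; rewrite /bary_a; ring.
Qed.

Lemma vol3_chart2 u (S : set V) : 0 < bary_a u -> 0 < u.2 -> measurable S ->
  vol3 R (chart2 u @^-1` S) = ((bary_a u * u.2 / 6)%:E * vol3 R S)%E.
Proof.
move=> u1 u3 mS; rewrite -(@vol3_chart1 (swapAB u) S u1 u3 mS).
have mT : measurable (chart1 (swapAB u) @^-1` S).
  by rewrite -[X in measurable X]setTI; exact: measurable_chart1.
exact: (vol3_swapAB mT).
Qed.

(** The inequalities of [tetra1] say that the barycentric weights relative to [A], [u], [C], [E] are
    positive, and the chart turns these into the weights relative to [A], [B], [C], [D]. *)
Lemma chart1_tetra u p : open_tetra u ->
  open_tetra (chart1 u p) <-> tetra1 u p.
Proof.
move=> [u1 u2 u3 u4].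
have u1n : u.1.1 != 0 by rewrite gt_eqF.
have u3n : u.2 != 0 by rewrite gt_eqF.
rewrite /open_tetra /tetra1 /mkset.
have E1 : (0 < (chart1 u p).1.1) = (0 < p.1.1) by rewrite /= pmulr_lgt0// invr_gt0.
have E2 : (0 < (chart1 u p).1.2) = (u.1.2 * p.2 < p.1.2 * u.2).
  by rewrite /= subr_gt0 mulrAC ltr_pdivrMr.
have E3 : (0 < (chart1 u p).2) = (p.1.1 * u.2 < p.2 * u.1.1).
  rewrite /= pmulr_rgt0// subr_gt0 ltr_pdivrMr// mulrAC ltr_pdivlMr//.
have E4 : (0 < bary_a (chart1 u p)) = (p.2 * (1 - u.1.2) < (1 - p.1.2) * u.2).
  have -> : bary_a (chart1 u p) = ((1 - p.1.2) * u.2 - p.2 * (1 - u.1.2)) / u.2.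
    by rewrite /bary_a /=; field; rewrite u1n u3n.
  by rewrite pmulr_lgt0 ?invr_gt0// subr_gt0.
by rewrite E1 E2 E3 E4; split=> -[].
Qed.

Lemma chart2_tetra u p : open_tetra u ->
  open_tetra (chart2 u p) <-> tetra2 u p.
Proof.
move=> uT; apply: iff_trans (chart1_tetra (swapAB p) (swapAB_tetra uT)) _.
by rewrite /tetra1 /tetra2 /=.
Qed.

Lemma tetra1_sub u p : open_tetra u -> tetra1 u p -> open_tetra p.
Proof.
move=> uT pT; have [p3 pa] := tetra1_ge uT pT.
have [u1 u2 u3 u4] := uT; have [p1 P1 P2 P3] := pT; split=> //.
- by rewrite -(pmulr_lgt0 _ u3) (le_lt_trans _ P2)// mulr_ge0// ltW.
- by rewrite -(pmulr_lgt0 _ u3) (lt_le_trans _ pa)// mulr_gt0.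
Qed.

Lemma tetra2_sub u p : open_tetra u -> tetra2 u p -> open_tetra p.
Proof.
move=> uT pT; have [p3 pa] := tetra2_ge uT pT.
have [u1 u2 u3 u4] := uT; have [p1 P1 P2 P3] := pT; split=> //.
- by rewrite -(pmulr_lgt0 _ u3) (lt_le_trans _ pa)// mulr_gt0.
- by rewrite -(pmulr_lgt0 _ u3) (le_lt_trans _ P2)// mulr_ge0// ltW.
Qed.

Lemma chart1_linear u : linear (chart1 u).
Proof.
move=> a p q; apply: prod3_eq; rewrite /= /GRing.scale /=; ring.
Qed.

Lemma chart1_surj u q : open_tetra u -> exists p, chart1 u p = q.
Proof.
move=> [u1 u2 u3 u4].
exists (q.1.1 * u.1.1, q.1.2 + u.1.2 * (q.2 / 6 + q.1.1), (q.2 / 6 + q.1.1) * u.2).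
by apply: prod3_eq => /=; field; rewrite !gt_eqF.
Qed.

Lemma exposed_chart1 (I : finType) (J : {set I}) (pt : I -> V) u :
  open_tetra u -> exposed (floor3 R) J (chart1 u \o pt) ->
  exposed (tri (vA R) u (vC R)) J pt.
Proof.
move=> uT; have [u1 u2 u3 u4] := uT.
pose fL := GRing.isLinear.Build R V V *:%R (chart1 u) (@chart1_linear u).
pose f : {linear V -> V} := HB.pack (chart1 u) fL.
have -> : floor3 R = chart1 u \o tri (vA R) u (vC R).
  have n1 : u.1.1 != 0 by rewrite gt_eqF.
  have n3 : u.2 != 0 by rewrite gt_eqF.
  by apply/funext; apply: ord3P; apply: prod3_eq => /=; field; rewrite ?n1 ?n3.
apply: (@exposed_affine _ _ _ _ _ _ _ f) => [q q'|y].
  by rewrite -(raddfB f).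
exact: chart1_surj.
Qed.

Definition swapAB_lin p : V := (- p.1.1 - p.1.2 - p.2 / 6, p.1.2, p.2).

Lemma exposed_chart2 (I : finType) (J : {set I}) (pt : I -> V) u :
  open_tetra u -> exposed (floor3 R) J (chart2 u \o pt) ->
  exposed (tri (vB R) u (vC R)) J pt.
Proof.
move=> uT; have [u1 u2 u3 u4] := uT; have sT := swapAB_tetra uT.
have flin : linear (chart1 (swapAB u) \o swapAB_lin).
  move=> a p q; apply: prod3_eq; rewrite /= /GRing.scale /=; ring.
pose fL := GRing.isLinear.Build R V V *:%R _ flin.
pose f : {linear V -> V} := HB.pack (chart1 (swapAB u) \o swapAB_lin) fL.
have -> : floor3 R = chart2 u \o tri (vB R) u (vC R).
  have n1 : bary_a u != 0 by rewrite gt_eqF.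
  have n3 : u.2 != 0 by rewrite gt_eqF.
  apply/funext; apply: ord3P; apply: prod3_eq => /=;
    rewrite ?divff// ?/(bary_a (_, _)) ?/(bary_a (_, _, _)) /=; field;
    by rewrite ?n1 ?n3.
apply: (@exposed_affine _ _ _ _ _ _ _ f) => [q q'|y].
  by apply: prod3_eq; rewrite /= /bary_a /=; ring.
(* [swapAB_lin], the linear part of [swapAB], is its own inverse. *)
have [p <-] := chart1_surj y sT; exists (swapAB_lin p).
congr chart1; apply: prod3_eq => //=; ring.
Qed.

End subtetrahedra.

(** * Independent uniform points *)

Section tetra_law.
Variable R : realType.
Notation V := (space3 R).

(** The uniform law on [T], whose volume is 1; it is real-valued so that finite products are
    products of reals. *)
Definition law (B : set V) : R := fine (vol3 R (B `&` @open_tetra R)).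

Lemma lawE (B : set V) : measurable B -> (law B)%:E = vol3 R (B `&` @open_tetra R).
Proof.
move=> mB; rewrite /law fineK// ge0_fin_numE//.
apply: (@le_lt_trans _ _ (vol3 R (@open_tetra R))).
  apply: le_measure; rewrite ?inE; [|exact: measurable_open_tetra|].
    by apply: measurableI => //; exact: measurable_open_tetra.
  exact: subIsetr.
by rewrite vol3_open_tetra ltry.
Qed.

Lemma lawT : law setT = 1.
Proof. by rewrite /law setTI vol3_open_tetra. Qed.

End tetra_law.

Section configurations.
Context {R : realType} (I : finType).
Notation V := (space3 R).

Definition rectangles : set (set (I -> V)) :=
  [set A | exists2 B : I -> set V, (forall i, measurable (B i)) &
                                   A = [set x | forall i, B i (x i)]].

(** The product sigma-algebra on families of points. *)
Definition config := g_sigma_algebraType rectangles.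

Lemma measurable_config_coord (i : I) :
  measurable_fun setT (fun x : config => x i).
Proof.
move=> _ B mB; rewrite setTI; apply: sub_sigma_algebra.
exists (fun j => if j == i then B else setT) => [j|]; first by case: eqP.
apply/seteqP; split=> x /= => [Bx j|/(_ i)]; last by rewrite eqxx.
by case: eqP => // ->.
Qed.

Section maps.
Context {d : measure_display} {Omega : measurableType d}.
Variable U : I -> Omega -> V.
Hypothesis mU : forall i, measurable_fun setT (U i).

Lemma measurable_rectangle (B : I -> set V) : (forall i, measurable (B i)) ->
  measurable [set w | forall i, B i (U i w)].
Proof.
move=> mB; rewrite (_ : [set w | _] = \bigcap_(i in setT) (U i @^-1` B i)).
  apply: fin_bigcap_measurable => // i _.
  by rewrite -[X in measurable X]setTI; exact: mU.
by apply/seteqP; split=> w /= h i => [_|]; exact: h.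
Qed.

Lemma measurable_config : measurable_fun setT (fun w => (U^~ w : config)).
Proof.
apply: (@measurability _ _ Omega config _ _ rectangles) => //.
move=> _ [_ [B mB ->] <-]; rewrite setTI; exact: measurable_rectangle.
Qed.

Lemma measurable_config_preimage (S : set config) : measurable S ->
  measurable [set w | S (U^~ w)].
Proof.
by move=> mS; have := measurable_config measurableT mS; rewrite setTI.
Qed.

(* Independence together with uniformity on the tetrahedron. *)
Definition iid (mu : set Omega -> \bar R) : Prop :=
  forall B : I -> set V, (forall i, measurable (B i)) ->
    mu [set w | forall i, B i (U i w)] = (\prod_i law (B i))%:E.

End maps.

(** Rectangles are stable under intersection and generate, so the joint law is determined by its
    values on them. This allows a family to be replaced by one on another space. *)
Lemma iid_unique d (Omega : measurableType d) d' (Omega' : measurableType d')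
    (mu : {measure set Omega -> \bar R}) (mu' : {measure set Omega' -> \bar R})
    (U : I -> Omega -> V) (U' : I -> Omega' -> V) (S : set config) :
  (forall i, measurable_fun setT (U i)) ->
  (forall i, measurable_fun setT (U' i)) ->
  iid U mu -> iid U' mu' -> measurable S ->
  mu [set w | S (U^~ w)] = mu' [set w | S (U'^~ w)].
Proof.
move=> mU mU' iidU iidU' mS.
have mf := measurable_config mU; have mf' := measurable_config mU'.
apply: (@measure_unique _ R config rectangles (fun=> setT) _ _ _ _
  (pushforward mu (fun w => (U^~ w : config)))
  (pushforward mu' (fun w => (U'^~ w : config)))) => //.
- move=> _ _ [B mB ->] [C mC ->]; exists (fun i => B i `&` C i) => [i|].
    exact: measurableI.
  apply/seteqP; split=> x /= => [[Bx Cx] i|BCx]; first by split.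
  by split=> i; have [] := BCx i.
- by move=> _; exists (fun=> setT) => //; apply/seteqP; split.
- by apply/seteqP; split=> // x _; exists 0%N.
- by move=> _ [B mB ->]; exact: etrans (iidU B mB) (esym (iidU' B mB)).
- move=> _; have := iidU (fun=> setT) (fun=> measurableT).
  rewrite (_ : [set w | _] = (fun w => U^~ w) @^-1` setT); last first.
    by apply/seteqP; split.
  by move=> E; rewrite [ltLHS]E ltry.
Qed.

End configurations.

(** * Conditioning on a subtetrahedron, and independent copies *)

Section conditioning.
Context {R : realType} (I : finType) {d : measure_display}
  {Omega : measurableType d}.
Notation V := (space3 R).
Variables (P : probability Omega R) (U : I -> Omega -> V).
Hypotheses (mU : forall i, measurable_fun setT (U i)) (iidU : iid U P).
Variables (J : {set I}) (phi : V -> V) (c : R).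
Hypotheses (c0 : 0 < c) (mphi : measurable_fun setT phi).
Hypothesis vol_phi : forall B, measurable B ->
  vol3 R (phi @^-1` B) = (c%:E * vol3 R B)%E.
Hypothesis phi_sub : forall p, open_tetra (phi p) -> open_tetra p.

Let pullback (B : I -> set V) (i : I) : set V :=
  if i \in J then phi @^-1` (B i `&` @open_tetra R) else B i.

Let mpullback B : (forall i, measurable (B i)) ->
  forall i, measurable (pullback B i).
Proof.
move=> mB i; rewrite /pullback; case: ifPn => // _.
rewrite -[X in measurable X]setTI; apply: mphi => //.
by apply: measurableI => //; exact: measurable_open_tetra.
Qed.

Let law_pullback B : (forall i, measurable (B i)) ->
  \prod_i law (pullback B i) = c ^+ #|J| * \prod_i law (B i).
Proof.
move=> mB; rewrite -prodr_const [X in X * _]big_mkcond -big_split /=.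
apply: eq_bigr => i _; rewrite /pullback; case: ifPn => _; last by rewrite mul1r.
have mo := @measurable_open_tetra R.
apply: EFin_inj; rewrite EFinM !lawE//; last first.
  rewrite -[X in measurable X]setTI; apply: mphi => //; exact: measurableI.
rewrite -vol_phi; last exact: measurableI.
congr (vol3 R _); apply/seteqP; split=> p /= => [[]|[Bp Tp]] //.
by split=> //; exact: phi_sub.
Qed.

(** [P'] is [P] conditioned on the points of [J] having their images in [T]. This event is a
    rectangle, so independence survives, and since [phi] scales volumes by a constant the images of
    these points are again uniform. *)
Lemma conditional_iid : exists P' : probability Omega R,
  iid (fun i w => if i \in J then phi (U i w) else U i w) P' /\
  forall E, measurable E ->
    P (E `&` [set w | forall j, j \in J -> open_tetra (phi (U j w))]) =
    ((c ^+ #|J|)%:E * P' E)%E.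
Proof.
set G := [set w | _].
have mT (i : I) : measurable [set: V] by exact: measurableT.
have GE : G = [set w | forall i, pullback (fun=> setT) i (U i w)].
  apply/seteqP; split=> w /= h i; rewrite ?/pullback; last first.
    by move=> iJ; have := h i; rewrite /pullback iJ => -[].
  by case: ifPn => // iJ; split=> //; exact: h.
have mG : measurable G.
  by rewrite GE; apply: measurable_rectangle => //; exact: mpullback.
have cJ : 0 < c ^+ #|J| by exact: exprn_gt0.
have PG : P G = (c ^+ #|J|)%:E.
  rewrite GE iidU; last exact: mpullback.
  by rewrite law_pullback// big1 ?mulr1// => i _; rewrite lawT.
exists (mnormalize (mrestr P mG) P).
have P'E E : mnormalize (mrestr P mG) P E = (P (E `&` G) * (c ^+ #|J|)^-1%:E)%E.
  have evT : mrestr P mG setT = (c ^+ #|J|)%:E by rewrite /mrestr setTI PG.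
  (* [mnormalize] falls back on [P] when the mass is 0 or infinite; here it is [c ^+ #|J|], which is
     positive and finite. *)
  transitivity (if (mrestr P mG setT == 0%E) || (mrestr P mG setT == +oo%E)
      then P E else P (E `&` G) * (fine (mrestr P mG setT))^-1%:E)%E.
    by rewrite /mnormalize; case: ifP.
  by rewrite evT /= ifF// eqe gt_eqF.
split=> [B mB|E mE]; last first.
  by rewrite [X in (_ * X)%E]P'E muleCA -EFinM divff ?mule1// gt_eqF.
rewrite [LHS]P'E (_ : _ `&` G = [set w | forall i, pullback B i (U i w)]); last first.
  apply/seteqP; split=> w /=.
    move=> [h g] i; have := h i; rewrite /pullback; case: ifPn => // iJ Bi.
    by split=> //; exact: g.
  move=> h; split=> [i|i iJ]; have := h i; rewrite /pullback.
    by case: ifPn => // _ -[].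
  by rewrite iJ => -[].
rewrite iidU; last exact: mpullback.
rewrite law_pullback// -EFinM; congr _%:E.
by rewrite mulrAC divff ?mul1r// gt_eqF.
Qed.

End conditioning.

Section mixing.
Context {R : realType} (I : finType) {d : measure_display}
  {Omega : measurableType d}.
Notation V := (space3 R).
Variables (P : probability Omega R) (U : I -> Omega -> V).
Hypotheses (mU : forall i, measurable_fun setT (U i)) (iidU : iid U P).
Variables (i : I) (J : {set I}).

(* Three independent copies of Omega carry the point i, the points with indices
   in J, and the remaining points. *)
Definition mix (j : I) (w : Omega * (Omega * Omega)) : V :=
  if j == i then U j w.1 else if j \in J then U j w.2.1 else U j w.2.2.

Definition mix_measure := prod_measure P (prod_measure P P).

Lemma measurable_mix j : measurable_fun setT (mix j).
Proof.
rewrite /mix; case: (j == i); first exact: measurableT_comp.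
by case: (j \in J); apply: (measurableT_comp (mU j)); exact: measurableT_comp.
Qed.

Lemma prod_measureE (d1 d2 : measure_display) (T1 : measurableType d1)
    (T2 : measurableType d2) (m1 : {sigma_finite_measure set T1 -> \bar R})
    (m2 : {sigma_finite_measure set T2 -> \bar R}) A B :
  measurable A -> measurable B ->
  prod_measure m1 m2 (A `*` B) = (m1 A * m2 B)%E.
Proof. exact: product_measure1E. Qed.

(** The joint law is unchanged, but fixing the first copy now fixes the point [i], with the two
    groups of other points on independent factors. *)
Lemma iid_mix : iid mix mix_measure.
Proof.
move=> B mB.
(* Each index is constrained in exactly one of the three factors; the other two contribute
   [law setT = 1]. *)
pose BX j := if j == i then B j else setT.
pose BY j := if j == i then setT else if j \in J then B j else setT.
pose BZ j := if j == i then setT else if j \in J then setT else B j.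
have mX j : measurable (BX j) by rewrite /BX; case: eqP.
have mY j : measurable (BY j) by rewrite /BY; case: eqP => // _; case: ifPn.
have mZ j : measurable (BZ j) by rewrite /BZ; case: eqP => // _; case: ifPn.
have MX := measurable_rectangle mU mX.
have MY := measurable_rectangle mU mY.
have MZ := measurable_rectangle mU mZ.
rewrite (_ : [set w | _] = [set w | forall j, BX j (U j w)] `*`
    ([set w | forall j, BY j (U j w)] `*` [set w | forall j, BZ j (U j w)])).
  rewrite /mix_measure (prod_measureE _ _ MX (measurableX MY MZ)).
  rewrite [X in (_ * X)%E](prod_measureE P P MY MZ).
  rewrite [X in (X * _)%E](iidU mX) [X in (_ * (X * _))%E](iidU mY).
  rewrite [X in (_ * (_ * X))%E](iidU mZ) -!EFinM -!big_split /=; congr _%:E.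
  apply: eq_bigr => j _; rewrite /BX /BY /BZ.
  by case: eqP => _; [|case: ifPn => _]; rewrite !lawT ?mulr1 ?mul1r.
apply/seteqP; split=> -[w [w1 w2]] /=.
  move=> h; split; [|split] => j; have := h j; rewrite /mix /BX /BY /BZ /=;
  by case: eqP => //= _; case: ifPn.
move=> [hX [hY hZ]] j; have := hX j; have := hY j; have := hZ j.
by rewrite /mix /BX /BY /BZ /=; case: eqP => //= _; case: ifPn.
Qed.

End mixing.

Section measurable_events.
Context {R : realType} {d : measure_display} {M : measurableType d}.
Notation V := (space3 R).
Implicit Types f g : M -> V.

Lemma measurable_preimage_open_tetra f : measurable_fun setT f ->
  measurable [set w | open_tetra (f w)].
Proof.
move=> mf; have := mf measurableT _ (@measurable_open_tetra R).
by rewrite setTI.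
Qed.

Lemma measurable_tetra1 f g : measurable_fun setT f -> measurable_fun setT g ->
  measurable [set w | tetra1 (f w) (g w)].
Proof.
move=> mf mg.
have f1 := measurable_coord ord0 mf.
have f2 := measurable_coord (lift ord0 ord0) mf.
have f3 := measurable_coord ord_max mf.
have g1 := measurable_coord ord0 mg.
have g2 := measurable_coord (lift ord0 ord0) mg.
have g3 := measurable_coord ord_max mg.
rewrite (_ : [set w | _] = [set w | 0 < (g w).1.1] `&`
    [set w | (g w).1.1 * (f w).2 < (g w).2 * (f w).1.1] `&`
    [set w | (f w).1.2 * (g w).2 < (g w).1.2 * (f w).2] `&`
    [set w | (g w).2 * (1 - (f w).1.2) < (1 - (g w).1.2) * (f w).2]); last first.
  by apply/seteqP; split => w [] => [? ? ? ?|[[? ?] ?] ?].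
have mM (a b : M -> R) : measurable_fun setT a -> measurable_fun setT b ->
  measurable_fun setT (fun w => a w * b w) by exact: measurable_funM.
have mB (a : M -> R) : measurable_fun setT a ->
  measurable_fun setT (fun w => 1 - a w) by exact: measurable_funB.
apply: measurableI; [apply: measurableI; [apply: measurableI|]|].
- exact: measurable_ltP.
- by apply: measurable_ltP; exact: mM.
- by apply: measurable_ltP; exact: mM.
- by apply: measurable_ltP; apply: mM => //; exact: mB.
Qed.

Lemma measurable_tetra2 f g : measurable_fun setT f -> measurable_fun setT g ->
  measurable [set w | tetra2 (f w) (g w)].
Proof.
move=> mf mg; apply: (@measurable_tetra1 (@swapAB R \o f) (@swapAB R \o g));
  by apply: measurableT_comp => //; exact: measurable_swapAB.
Qed.

Lemma measurable_forall_in (I : finType) (J : {set I}) (A : I -> set M) :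
  (forall i, measurable (A i)) -> measurable [set w | forall j, j \in J -> A j w].
Proof.
move=> mA; rewrite (_ : [set w | _] = \bigcap_(j in [set` J]) A j).
  by apply: fin_bigcap_measurable.
by apply/seteqP; split=> w /= h j; exact: h.
Qed.

Lemma measurable_exposed_tri (I : finType) (J : {set I}) (a c : V) f
    (U : I -> M -> V) :
  measurable_fun setT f -> (forall i, measurable_fun setT (U i)) ->
  measurable [set w | exposed (tri a (f w) c) J (U^~ w)].
Proof.
move=> mf mU.
apply: (@measurable_exposed _ _ M I (fun k w => tri a (f w) c k)) => //.
by apply: ord3P; rewrite /tri /=.
Qed.

End measurable_events.

(** * The recursive lower bound *)

Lemma exposed_congr (R : realType) (I : finType) (F : 'I_3 -> space3 R)
    (J : {set I}) (p q : I -> space3 R) :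
  (forall j, j \in J -> p j = q j) -> exposed F J p -> exposed F J q.
Proof.
move=> pq ep i iJ; rewrite (_ : gens _ _ _ _ = gens F J p (p i)); first exact: ep.
apply/funext => -[k|j] /=; rewrite -(pq i iJ)//.
by case: ifPn => // jJ; rewrite (pq j jJ).
Qed.

Lemma sum_disjoint_measure d (T : measurableType d) (R : realType)
    (mu : {measure set T -> \bar R}) (I : finType) (F : I -> set T) (A : set T) :
  (forall i, measurable (F i)) -> measurable A ->
  (forall i j x, F i x -> F j x -> i = j) -> (forall i, F i `<=` A) ->
  (\sum_i mu (F i) <= mu A)%E.
Proof.
move=> mF mA Fdisj FA.
have mU r : measurable [set x | exists2 i, i \in r & F i x].
  rewrite (_ : [set x | _] = \bigcup_(i in [set` r]) F i); last first.
    by apply/seteqP; split=> x [i ir Fx]; exists i.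
  by apply: fin_bigcup_measurable => //; exact: finite_seq.
have sumE r : uniq r ->
    (\sum_(i <- r) mu (F i))%E = mu [set x | exists2 i, i \in r & F i x].
  elim: r => [_|i r ih /= /andP[ir ur]].
    rewrite big_nil (_ : [set x | _] = set0) ?measure0//.
    by apply/seteqP; split=> x // [].
  rewrite big_cons ih//; set B := [set x | _].
  have -> : [set x | exists2 j, j \in i :: r & F j x] = F i `|` B.
    apply/seteqP; split=> x /=.
      by move=> [j]; rewrite inE => /predU1P[-> Fx|jr Fx]; [left|right; exists j].
    by move=> [Fx|[j jr Fx]]; [exists i|exists j] => //; rewrite inE ?eqxx// jr orbT.
  apply/esym; apply: measureU; [exact: mF|exact: mU|].
  apply/seteqP; split=> x //= [Fix [j jr Fjx]].
  by move: ir; rewrite (Fdisj _ _ _ Fix Fjx) jr.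
rewrite sumE; last exact: index_enum_uniq.
by apply: le_measure; rewrite ?inE// => x [i _ /FA].
Qed.

Section split.
Context {R : realType} (I : finType) {d : measure_display}
  {Omega : measurableType d}.
Notation V := (space3 R).

(* A lower bound, for any i.i.d. uniform family, on the probability that the
   points with indices in J are exposed. *)
Definition exposed_bound (J : {set I}) (l : R) : Prop :=
  forall (P : probability Omega R) (U : I -> Omega -> V),
    (forall i, measurable_fun setT (U i)) -> iid U P ->
    (l%:E <= P [set w | exposed (floor3 R) J (U^~ w)])%E.

(** Each point of [J] falls into [T] with probability [c]; given that all do, the charted points are
    again i.i.d. uniform and the bound [l] applies to them. *)
Lemma chart_bound (P : probability Omega R) (U : I -> Omega -> V)
    (J : {set I}) (l c : R) (phi : V -> V) (T : set V) (F : 'I_3 -> V) :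
  (forall i, measurable_fun setT (U i)) -> iid U P -> exposed_bound J l ->
  0 < c -> measurable_fun setT phi ->
  (forall B, measurable B -> vol3 R (phi @^-1` B) = (c%:E * vol3 R B)%E) ->
  (forall p, open_tetra (phi p) <-> T p) ->
  (forall p, T p -> open_tetra p) ->
  (forall x : I -> V, exposed (floor3 R) J (phi \o x) -> exposed F J x) ->
  let A := [set w | (forall j, j \in J -> T (U j w)) /\ exposed F J (U^~ w)] in
  measurable A -> ((c ^+ #|J| * l)%:E <= P A)%E.
Proof.
move=> mU iidU lJ c0 mphi vphi phiT Tsub phiF A mA.
have phisub p : open_tetra (phi p) -> open_tetra p by move/phiT/Tsub.
have [P' [iidU' P'E]] := conditional_iid mU iidU J c0 mphi vphi phisub.
pose U' i w := if i \in J then phi (U i w) else U i w.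
have mU' i : measurable_fun setT (U' i).
  by rewrite /U'; case: (i \in J) => //; exact: measurableT_comp.
have mE : measurable [set w | exposed (floor3 R) J (U'^~ w)].
  by apply: (@measurable_exposed _ _ Omega I (fun k _ => floor3 R k)).
have mG : measurable [set w | forall j, j \in J -> open_tetra (phi (U j w))].
  apply: (@measurable_forall_in _ Omega I J (fun j => [set w | open_tetra (phi (U j w))])) => j.
  by apply: measurable_preimage_open_tetra; exact: measurableT_comp.
have := lJ P' U' mU' iidU' => lP'.
rewrite EFinM; apply: (@le_trans _ _ ((c ^+ #|J|)%:E *
    P' [set w | exposed (floor3 R) J (U'^~ w)])%E).
  by rewrite lee_wpmul2l// lee_fin exprn_ge0// ltW.
rewrite -P'E//; apply: le_measure; rewrite ?inE//; first exact: measurableI.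
move=> w [/= ew Gw]; split=> [j jJ|]; first by apply/phiT; exact: Gw.
apply: phiF; apply: exposed_congr ew => j jJ.
by rewrite /U' jJ.
Qed.

(** A set of configurations rather than of outcomes, so that its probability depends on the joint
    law only. *)
Definition split_event (i : I) (J1 J2 : {set I}) : set (config (R := R) I) :=
  [set x | [/\ open_tetra (x i),
    forall j, j \in J1 -> tetra1 (x i) (x j),
    forall j, j \in J2 -> tetra2 (x i) (x j),
    exposed (tri (vA R) (x i) (vC R)) J1 x &
    exposed (tri (vB R) (x i) (vC R)) J2 x]].

Lemma measurable_split_event i J1 J2 : measurable (split_event i J1 J2).
Proof.
have mc := @measurable_config_coord R I.
rewrite (_ : split_event i J1 J2 =
  [set x : config I | open_tetra (x i)] `&`
  [set x : config I | forall j, j \in J1 -> [set x | tetra1 (x i) (x j)] x] `&`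
  [set x : config I | forall j, j \in J2 -> [set x | tetra2 (x i) (x j)] x] `&`
  [set x : config I | exposed (tri (vA R) (x i) (vC R)) J1 x] `&`
  [set x : config I | exposed (tri (vB R) (x i) (vC R)) J2 x]); last first.
  by apply/seteqP; split=> x [] => [? ? ? ? ?|[[[? ?] ?] ?] ?].
apply: measurableI; last exact: (measurable_exposed_tri J2 _ _ (mc i) mc).
apply: measurableI; last exact: (measurable_exposed_tri J1 _ _ (mc i) mc).
apply: measurableI; last first.
  by apply: measurable_forall_in => j; exact: measurable_tetra2.
apply: measurableI; last first.
  by apply: measurable_forall_in => j; exact: measurable_tetra1.
exact: measurable_preimage_open_tetra.
Qed.

Lemma split_event_exposed i (J1 J2 : {set I}) (x : I -> V) :
  split_event i J1 J2 x -> exposed (floor3 R) (i |: (J1 :|: J2)) x.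
Proof. by move=> [? ? ? ? ?]; exact: exposed_glue. Qed.

Section bound.
Variables (P : probability Omega R) (U : I -> Omega -> V).
Hypotheses (mU : forall i, measurable_fun setT (U i)) (iidU : iid U P).

Lemma integral_iid (f : V -> \bar R) (i : I) : measurable_fun setT f ->
  (forall p, 0 <= f p)%E -> (forall p, ~ open_tetra p -> f p = 0%E) ->
  (\int[P]_w f (U i w) = \int[vol3 R]_(p in @open_tetra R) f p)%E.
Proof.
move=> mf f0 fT; have mo := @measurable_open_tetra R.
have mE A : measurable A -> mrestr (vol3 R) mo A = P (U i @^-1` A).
  move=> mA; rewrite /mrestr -lawE//.
  rewrite (_ : U i @^-1` A = [set w | forall j, (if j == i then A else setT) (U j w)]).
    rewrite (iidU (B := fun j => if j == i then A else setT)); last first.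
      by move=> j; case: eqP.
    rewrite (bigD1 i)//= eqxx big1 ?mulr1// => j /negPf ->.
    by rewrite lawT.
  apply/seteqP; split=> w /= => [Aw j|/(_ i)]; last by rewrite eqxx.
  by case: eqP => // ->.
transitivity (\int[mrestr (vol3 R) mo]_p f p)%E.
  by apply/esym; apply: integral_transfer; [exact: mU|exact: mf|exact: f0|exact: mE].
transitivity (\int[mrestr (vol3 R) mo]_(p in @open_tetra R) f p)%E.
  rewrite [RHS]integral_mkcond; apply: eq_integral => p _.
  rewrite patchE; case: ifPn => // /negP pT.
  by rewrite fT// => pT'; apply: pT; rewrite inE.
apply: eq_measure_integral => A mA AT.
have E : mrestr (vol3 R) mo A = vol3 R A by rewrite /mrestr setIidl.
exact: E.
Qed.

(** On the three copies, Tonelli's theorem fixes [u] in the first. The section of the event then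
    contains a product [A1 * A2] over the other two, to whose factors [chart_bound] applies with
    constants bd and ad; integrating over [u] gives the Dirichlet integral. *)
Lemma split_event_bound i (J1 J2 : {set I}) (l1 l2 : R) :
  i \notin J1 -> i \notin J2 -> (forall j, j \in J2 -> j \notin J1) ->
  0 <= l1 -> 0 <= l2 -> exposed_bound J1 l1 -> exposed_bound J2 l2 ->
  ((l1 * l2 * (6 * ((#|J1|)`! * (#|J2|)`! * (#|J1| + #|J2|)`!)%:R /
      (2 * (#|J1| + #|J2|) + 3)`!%:R))%:E <=
   P [set w | split_event i J1 J2 (U^~ w)])%E.
Proof.
move=> iJ1 iJ2 J12 l10 l20 b1 b2.
set k := #|J1|; set m := #|J2|.
have mS := measurable_split_event i J1 J2.
rewrite (iid_unique (mu' := mix_measure P) mU (measurable_mix mU i J1)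
  iidU (iid_mix mU iidU i J1) mS).
set A := [set w | _].
have mA : measurable A.
  exact: (measurable_config_preimage (measurable_mix mU i J1) mS).
have l12 : 0 <= l1 * l2 by exact: mulr_ge0.
have mo := @measurable_open_tetra R.
pose f : V -> \bar R :=
  (EFin \o (fun p => l1 * l2 * dirichlet_integrand k m p)) \_ (@open_tetra R).
have mf : measurable_fun setT f.
  apply/(measurable_restrictT _ _).1 => //; apply/measurable_EFinP.
  apply: measurable_funTS; apply: measurable_funM => //.
  exact: measurable_dirichlet_integrand.
have f0 p : (0 <= f p)%E.
  rewrite /f patchE; case: ifPn => // /set_mem pT.
  by rewrite lee_fin mulr_ge0// dirichlet_integrand_ge0.
have -> : (l1 * l2 * (6 * (k`! * m`! * (k + m)`!)%:R / (2 * (k + m) + 3)`!%:R))%:E =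
    (\int[P]_w f (U i w))%E.
  rewrite integral_iid//; last first.
    by move=> p pT; rewrite /f patchE memNset.
  rewrite EFinM -dirichlet_integral -ge0_integralZl_EFin//; last 2 first.
  - by move=> p pT; rewrite lee_fin dirichlet_integrand_ge0.
  - apply/measurable_EFinP; apply: measurable_funTS.
    exact: measurable_dirichlet_integrand.
  by apply: eq_integral => p pT; rewrite /f patchE pT.
rewrite /mix_measure /prod_measure /product_measure1.
apply: ge0_le_integral => //.
- exact: measurableT_comp mf (mU i).
- exact: (measurable_fun_xsection (prod_measure P P) mA).
move=> w _; rewrite /f patchE; case: ifPn => [/set_mem uT|_]; last exact: measure_ge0.
set u := U i w in uT *; have [u1 u2 u3 u4] := uT.
pose A1 := [set w | (forall j, j \in J1 -> tetra1 u (U j w)) /\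
  exposed (tri (vA R) u (vC R)) J1 (U^~ w)].
pose A2 := [set w | (forall j, j \in J2 -> tetra2 u (U j w)) /\
  exposed (tri (vB R) u (vC R)) J2 (U^~ w)].
have mu_ : measurable_fun setT (fun _ : Omega => u) by [].
have mA1 : measurable A1.
  apply: measurableI; last exact: measurable_exposed_tri.
  apply: (@measurable_forall_in _ Omega I J1 (fun j => [set w | tetra1 u (U j w)])) => j.
  exact: measurable_tetra1.
have mA2 : measurable A2.
  apply: measurableI; last exact: measurable_exposed_tri.
  apply: (@measurable_forall_in _ Omega I J2 (fun j => [set w | tetra2 u (U j w)])) => j.
  exact: measurable_tetra2.
have B1 : (((u.1.1 * u.2 / 6) ^+ k * l1)%:E <= P A1)%E.
  apply: (chart_bound mU iidU b1 _ (measurable_chart1 u)).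
  - by rewrite divr_gt0// mulr_gt0.
  - by move=> B; exact: vol3_chart1.
  - by move=> p; exact: chart1_tetra.
  - by move=> p; exact: tetra1_sub.
  - by move=> x; exact: exposed_chart1.
  - exact: mA1.
have B2 : (((bary_a u * u.2 / 6) ^+ m * l2)%:E <= P A2)%E.
  apply: (chart_bound mU iidU b2 _ (measurable_chart2 u)).
  - by rewrite divr_gt0// mulr_gt0.
  - by move=> B; exact: vol3_chart2.
  - by move=> p; exact: chart2_tetra.
  - by move=> p; exact: tetra2_sub.
  - by move=> x; exact: exposed_chart2.
  - exact: mA2.
apply: (@le_trans _ _ (P A1 * P A2)%E).
  rewrite /= /dirichlet_integrand !mulrA -[X in X%:E]mulrA mulrACA.
  rewrite [l1 * _]mulrC [l2 * _]mulrC EFinM.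
  apply: lee_pmul => //; rewrite lee_fin mulr_ge0// exprn_ge0// divr_ge0//;
    exact/ltW/mulr_gt0.
rewrite -[leLHS](prod_measureE P P mA1 mA2).
apply: le_measure; rewrite ?inE; [exact: measurableX| |].
  exact: measurable_xsection.
move=> [w1 w2] [[T1 E1] [T2 E2]]; rewrite /xsection /= inE /A /= /split_event /=.
have mi : mix U i J1 i (w, (w1, w2)) = u by rewrite /mix eqxx.
have m1 j : j \in J1 -> mix U i J1 j (w, (w1, w2)) = U j w1.
  move=> jJ; rewrite /mix jJ; case: eqP => // ji.
  by move: iJ1; rewrite -ji jJ.
have m2 j : j \in J2 -> mix U i J1 j (w, (w1, w2)) = U j w2.
  move=> jJ; rewrite /mix (negbTE (J12 _ jJ)); case: eqP => // ji.
  by move: iJ2; rewrite -ji jJ.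
rewrite mi; split.
- exact: uT.
- by move=> j jJ; rewrite m1//; exact: T1.
- by move=> j jJ; rewrite m2//; exact: T2.
- by apply: exposed_congr E1 => j /m1.
- by apply: exposed_congr E2 => j /m2.
Qed.

End bound.

End split.

(** * Summation over apexes and splittings, and the induction *)

Lemma sum_powerset (R : nzRingType) (T : finType) (A : {set T}) (n : nat)
    (h : nat -> R) : (#|A| < n)%N ->
  \sum_(B : {set T} | B \subset A) h #|B| =
  \sum_(0 <= k < n) h k *+ 'C(#|A|, k).
Proof.
move=> An.
transitivity (\sum_(B : {set T} | B \subset A)
    \sum_(0 <= k < n | k == #|B|) h k).
  apply: eq_bigr => B BA; rewrite big_nat1_eq /=.
  by rewrite (leq_ltn_trans (subset_leq_card BA) An).
rewrite (exchange_big_dep xpredT)//=; apply: eq_bigr => k _.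
rewrite sumr_const -cards_draws; congr (_ *+ _); apply: eq_card => B.
by rewrite !inE eq_sym.
Qed.

Section main_bound.
Variables (R : realType) (ell : nat -> R).
Hypothesis ell0 : ell 0%N = 1.
Hypothesis ell_rec : forall n : nat, (1 <= n)%N ->
  ell n = 6 * (((n - 1)`! * n`!)%N%:R / ((2 * n + 1)`!)%:R)
            * \sum_(0 <= k < n) ell k * ell (n - 1 - k)%N.

Lemma ell_ge0 n : 0 <= ell n.
Proof.
elim/ltn_ind: n => -[_|n ih]; first by rewrite ell0.
rewrite ell_rec// mulr_ge0// big_nat sumr_ge0// => k /andP[_ kn].
by rewrite mulr_ge0// ih//; lia.
Qed.

Definition split_weight (k m : nat) : R :=
  ell k * ell m * (6 * (k`! * m`! * (k + m)`!)%:R / (2 * (k + m) + 3)`!%:R).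

(** There are [n] choices of [i] and ['C(n - 1, k)] choices of [J1] of size [k]. The binomial
    coefficient cancels [k! (n - 1 - k)!] into [(n - 1)!], and the factor [n] turns the other
    [(n - 1)!] into [n!]. *)
Lemma ell_split (I : finType) (J : {set I}) : (0 < #|J|)%N ->
  ell #|J| = \sum_(i in J) \sum_(J1 : {set I} | J1 \subset J :\ i)
    split_weight #|J1| #|(J :\ i) :\: J1|.
Proof.
move=> J0; set n := #|J|.
pose h k : R := split_weight k (n - 1 - k)%N.
rewrite (eq_bigr (fun=> \sum_(0 <= k < n) h k *+ 'C(n - 1, k))) => [|i iJ]; last first.
  have Ji : #|J :\ i| = (n - 1)%N by rewrite /n (cardsD1 i J) iJ addKn.
  rewrite -Ji -(@sum_powerset _ _ (J :\ i) n h); last by rewrite Ji /n; lia.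
  by apply: eq_bigr => B BJ; rewrite cardsDS// Ji.
rewrite sumr_const -/n ell_rec// -[RHS]mulr_natl !mulr_sumr.
rewrite big_nat.
rewrite [RHS]big_nat; apply: eq_bigr => k /andP[_ kn].
have kn1 : (k <= n - 1)%N by lia.
rewrite /h /split_weight subnKC//.
have -> : (2 * (n - 1) + 3 = 2 * n + 1)%N by lia.
have -> : n`! = (n * (n - 1)`!)%N.
  by case: (n) (J0 : (0 < n)%N) => // m _; rewrite subn1 factS.
have E : (n - 1)`!%:R = 'C(n - 1, k)%:R * (k`!%:R * (n - 1 - k)`!%:R) :> R.
  by rewrite -!natrM bin_fact.
have alg (f b f1 f2 N D l l' : R) : f = b * (f1 * f2) ->
    6 * (f * (N * f) / D) * (l * l') =
    N * (b * (l * l' * (6 * (f1 * f2 * f) / D))) by move=> ->; ring.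
by rewrite -[X in n%:R * X]mulr_natl !natrM; exact: alg.
Qed.

(** Strong induction on the size of [J]: removing the apex makes both groups strictly smaller, and
    the induction hypothesis covers the conditioned probabilities. *)
Lemma exposed_ell (I : finType) d (Omega : measurableType d) (J : {set I}) :
  exposed_bound (Omega := Omega) J (ell #|J|).
Proof.
move Jn : #|J| => n; elim/ltn_ind: n J Jn => n ih J Jn P U mU iidU.
have mE : measurable [set w | exposed (floor3 R) J (U^~ w)].
  by apply: (@measurable_exposed _ _ Omega I (fun k _ => floor3 R k)).
have [n0|n0] := posnP n.
  rewrite (_ : [set w | _] = setT); last first.
    apply/seteqP; split=> // w _ /= i.
    by rewrite (cards0_eq (etrans Jn n0)) inE.
  by rewrite n0 ell0 probability_setT.
rewrite -Jn ell_split ?Jn// pair_big_dep /= big_mkcond /= -sumEFin.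
(* Inadmissible pairs get the empty event, so that the sum can run over all pairs. *)
pose F (q : I * {set I}) : set Omega :=
  if (q.1 \in J) && (q.2 \subset J :\ q.1)
  then [set w | split_event q.1 q.2 ((J :\ q.1) :\: q.2) (U^~ w)] else set0.
apply: (@le_trans _ _ (\sum_q P (F q))%E).
  apply: lee_sum => -[i J1] _; rewrite /F /=; case: ifPn => [/andP[iJ J1J]|_]; last first.
    exact: measure_ge0.
  have cJ : (#|J1| + #|(J :\ i) :\: J1|)%N = n.-1.
    rewrite cardsDS// subnKC ?subset_leq_card//.
    by rewrite -Jn (cardsD1 i J) iJ.
  apply: split_event_bound => //.
  - by apply/negP => /(fintype.subsetP J1J); rewrite !inE eqxx.
  - by rewrite !inE eqxx andbF.
  - by move=> j; rewrite inE => /andP[].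
  - exact: ell_ge0.
  - exact: ell_ge0.
  - by apply: ih => //; lia.
  - by apply: ih => //; lia.
apply: sum_disjoint_measure => //.
- move=> q; rewrite /F; case: ifP => // _.
  exact: (measurable_config_preimage mU (measurable_split_event _ _ _)).
- move=> [i J1] [i' J1'] w; rewrite /F /=.
  case: ifPn => // /andP[iJ J1J]; case: ifPn => // /andP[i'J J1J'].
  (* Every other point lies strictly below the rotating plane through the apex, so two distinct
     apexes would each lie strictly below the other. *)
  have lower k (K1 : {set I}) k' : K1 \subset J :\ k -> k' \in J -> k' != k ->
      split_event k K1 ((J :\ k) :\: K1) (U^~ w) ->
      (U k' w).2 * (1 - (U k w).1.2) < (1 - (U k' w).1.2) * (U k w).2.
    move=> K1J k'J k'k [_ T1 T2 _ _].
    have [k'K1|k'K1] := boolP (k' \in K1); first by have [] := T1 _ k'K1.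
    by have [] := T2 k'; rewrite ?inE ?k'K1 ?k'k.
  move=> S S'; have [ii'|ii'] := eqVneq i' i; last first.
    have := lower _ _ _ J1J i'J ii' S; rewrite ltNge => /negP[].
    rewrite mulrC [leRHS]mulrC ltW//; apply: lower J1J' iJ _ S'.
    by rewrite eq_sym.
  rewrite ii' in J1J' S' *; congr (_, _); apply/setP => j.
  case: S S' => [uT T1 T2 _ _] [_ T1' T2' _ _].
  have [jJ|jJ] := boolP (j \in J :\ i); last first.
    rewrite (contraNF (fintype.subsetP J1J j))// (contraNF (fintype.subsetP J1J' j))//.
  (* With the same apex, a point classified differently by the two splittings would lie in both
     subtetrahedra. *)
  apply/idP/idP => jJ1; apply: contraT => jJ1'; exfalso.
  + by apply: (tetra12_disj uT (T1 _ jJ1) (T2' _ _)); rewrite !inE jJ1' -in_setD1.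
  + by apply: (tetra12_disj uT (T1' _ jJ1) (T2 _ _)); rewrite !inE jJ1' -in_setD1.
- move=> [i J1] w; rewrite /F /=; case: ifPn => // /andP[iJ J1J].
  move=> /split_event_exposed; rewrite (_ : i |: _ = J)//.
  apply/setP => j; have := fintype.subsetP J1J j; rewrite !inE.
  have [->|_] := eqVneq j i; first by rewrite iJ.
  by move=> /=; case: (j \in J1) => /= [/(_ isT) ->|_].
Qed.

End main_bound.

Theorem theorem8 (R : realType) (ell : nat -> R)
    (ell0 : ell 0%N = 1)
    (ell_rec : forall n : nat, (1 <= n)%N ->
       ell n = 6 * (((n - 1)`! * n`!)%N%:R / ((2 * n + 1)`!)%:R)
                 * \sum_(0 <= k < n) ell k * ell (n - 1 - k)%N)
    (n : nat) (d : measure_display) (Omega : measurableType d)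
    (P : probability Omega R) (U : 'I_n -> {RV P >-> space3 R})
    (U_indep : mutually_independent U)
    (U_unif : forall i : 'I_n, uniform_on (tetrahedron R) (U i)) :
  ((ell n)%:E <= P (all_on_hull_boundary U))%E.
Proof.
have mU i : measurable_fun setT (U i) by exact: measurable_funP.
have iidU : iid (fun i => U i : Omega -> space3 R) P.
  move=> B mB; have := U_indep finset.setT B mB.
  rewrite (_ : \bigcap_(i in _) _ = [set w | forall i, B i (U i w)]); last first.
    by apply/seteqP; split=> w /= h i; [apply: h; rewrite /= inE|move=> _; exact: h].
  move=> ->; rewrite -prodEFin; apply: eq_big => [i|i _]; first by rewrite inE.
  rewrite lawE// -uniform_tetrahedronE//.
  exact: U_unif.
rewrite (_ : all_on_hull_boundary U =
    [set w | exposed (floor3 R) finset.setT (fun i => U i w)]); last first.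
  by apply/seteqP; split=> w /= /boundary_hullP.
have := @exposed_ell R ell ell0 ell_rec _ _ Omega [set: 'I_n]%SET P _ mU iidU.
by rewrite cardsT card_ord.
Qed.
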